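(* Let $p>0$ and let $u:\mathbb{R}^4\to\mathbb{R}$ be a solution to $\Delta^2 u=(1-|x|^p)e^{4u}$ in $\mathbb{R}^4$ with $(1-|y|^p)e^{4u}\in L^1(\mathbb{R}^4)$, $\Lambda:=\int_{\mathbb{R}^4}(1-|x|^p)e^{4u}dx$, and $$v(x):=\frac{1}{8\pi^2}\int_{\mathbb{R}^4}\log\left(\frac{|y|}{|x-y|}\right)(1-|y|^p)e^{4u(y)}\,dy.$$ Assume $v\in L^1_{loc}(\mathbb{R}^4)$ and that for every $\varepsilon>0$ there is $R>0$ such that for all $|x|\ge R$, $$-v(x)\le\frac{1}{8\pi^2}(\Lambda+5\varepsilon)\log|x|+\frac{1}{8\pi^2}\int_{B_1(x)}\log(|x-y|)(1-|y|^p)e^{4u(y)}\,dy.$$ Let $h:\mathbb{R}^4\to\mathbb{R}$ satisfy $\Delta^2h=0$ and $h\le u-v$ on $\mathbb{R}^4$. Then $h$ is a polynomial of degree at most $2$.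
   Context: $B_1(x)$ denotes the ball of radius $1$ centered at $x$. *)

(* Defs.v *)
From HB Require Import structures.
From mathcomp Require Import all_boot all_order all_algebra.
From mathcomp Require Import all_classical all_reals all_analysis.
Set Implicit Arguments. Unset Strict Implicit. Unset Printing Implicit Defensive.
Import Order.TTheory GRing.Theory Num.Theory.
Import numFieldNormedType.Exports.
Local Open Scope classical_set_scope.
Local Open Scope ring_scope.

Section R4.
Variable R : realType.

Definition pt4 := ((R * R) * (R * R))%type.

Definition coord4 (x : pt4) (i : 'I_4) : R :=
  match val i with
  | 0 => x.1.1 | 1 => x.1.2 | 2 => x.2.1 | _ => x.2.2
  end.

Definition mkpt4 (f : 'I_4 -> R) : pt4 :=
  ((f (inord 0), f (inord 1)), (f (inord 2), f (inord 3))).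

Definition enorm4 (x : pt4) : R := Num.sqrt (\sum_(i < 4) coord4 x i ^+ 2).
Definition edist4 (x y : pt4) : R :=
  Num.sqrt (\sum_(i < 4) (coord4 x i - coord4 y i) ^+ 2).

Definition ball4 (c : pt4) (r : R) : set pt4 := [set y | edist4 c y < r].

Definition addcoord4 (x : pt4) (i : 'I_4) (t : R) : pt4 :=
  mkpt4 (fun j => coord4 x j + (if j == i then t else 0)).

Definition dpart4 (i : 'I_4) (f : pt4 -> R) : pt4 -> R :=
  fun x => derive1 (fun t => f (addcoord4 x i t)) 0.

Fixpoint Ck4 (k : nat) (f : pt4 -> R) : Prop :=
  match k with
  | 0 => continuous f
  | k'.+1 => (forall i x, derivable (fun t => f (addcoord4 x i t)) 0 1)
             /\ forall i, Ck4 k' (dpart4 i f)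
  end.

Definition smooth4 (f : pt4 -> R) : Prop := forall k, Ck4 k f.

Definition lap4 (f : pt4 -> R) : pt4 -> R :=
  fun x => \sum_(i < 4) dpart4 i (dpart4 i f) x.
Definition bilap4 (f : pt4 -> R) : pt4 -> R := lap4 (lap4 f).

Definition leb4 := ((@lebesgue_measure R \x @lebesgue_measure R) \x
                    (@lebesgue_measure R \x @lebesgue_measure R))%E.

Definition test_fun4 (phi : pt4 -> R) : Prop :=
  smooth4 phi /\ exists r : R, forall x, r < enorm4 x -> phi x = 0.

Definition Lloc4 (f : pt4 -> R) : Prop :=
  forall r : R, leb4.-integrable (ball4 (mkpt4 (fun=> 0)) r) (EFin \o f).
Definition Lloc_e4 (f : pt4 -> \bar R) : Prop :=
  forall r : R, leb4.-integrable (ball4 (mkpt4 (fun=> 0)) r) f.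

Definition Kp4 (p : R) (y : pt4) : R := 1 - enorm4 y `^ p.

Definition dist_solution4 (p : R) (u : pt4 -> R) : Prop :=
  Lloc4 u /\
  forall phi, test_fun4 phi ->
    (\int[leb4]_x (u x * bilap4 phi x)%:E =
     \int[leb4]_x (Kp4 p x * expR (4 * u x) * phi x)%:E)%E.

Definition Lam4 (p : R) (u : pt4 -> R) : R :=
  fine (\int[leb4]_y (Kp4 p y * expR (4 * u y))%:E)%E.

(* v(x) := 1/(8 pi^2) int log(|y|/|x-y|) (1 - |y|^p) e^{4u(y)} dy,
   an extended real (finite exactly when the integral converges absolutely) *)
Definition vpot4 (p : R) (u : pt4 -> R) (x : pt4) : \bar R :=
  (((8 * pi ^+ 2)^-1)%:E *
   \int[leb4]_y (ln (enorm4 y / edist4 x y) * Kp4 p y * expR (4 * u y))%:E)%E.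

Definition poly_deg_le24 (h : pt4 -> R) : Prop :=
  exists (c : R) (b : 'I_4 -> R) (a : 'I_4 -> 'I_4 -> R),
    forall x, h x = c + \sum_(i < 4) b i * coord4 x i
                  + \sum_(i < 4) \sum_(j < 4) a i j * coord4 x i * coord4 x j.

End R4.

(* Main.v *)
Require Import Defs.
From HB Require Import structures.
From mathcomp Require Import all_boot all_order all_algebra.
From mathcomp Require Import all_classical all_reals all_analysis.
From mathcomp Require Import measurable_realfun ring lra.
Import Order.TTheory GRing.Theory Num.Theory.
Import numFieldNormedType.Exports.
Local Open Scope classical_set_scope.
Local Open Scope ring_scope.

(* Write A_k(z) = max(r^2 - |z - x|^2, 0)^k.  The Laplacian of A_(k+1) is a combination
   of A_(k-1) and A_k, so Green's identity against a biharmonic function h becomes a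
   recursion in k for the weighted means of h; with r fixed the weights concentrate at x
   as k -> oo, which yields the mean value formula
     int h A_k = (int A_k) (h(x) + r^2 (lap h)(x) / (4 (k + 3))).
   Combining k = 4 and k = 5 eliminates lap h and writes h(x) as the integral of h against
   an explicit C^3 kernel of scale r, so every third difference of h is
   O(r^-9) int |h| A, where A is A_1 of radius 8 r centered at 0.  Since |h| = 2 h^+ - h
   and int h A = O(r^8) by the mean value formula, it is enough to bound int h^+ A by
   O(r^8).  For |x| large, h^+ is at most u^+ plus a multiple of |x| plus the logarithmic
   potential of |1 - |y|^p| e^(4u) on B_1(x); here u <= e^(4u) <= |1 - |x|^p| e^(4u) is
   integrable, and so is the potential, by Tonelli.  Letting r -> oo, all third differences
   of h vanish, so h is quadratic. *)
Set Implicit Arguments. Unset Strict Implicit. Unset Printing Implicit Defensive.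

(** * Coordinates of R^4 *)

Section coordinates.
Variable R : realType.
Implicit Types (x y : pt4 R) (i j : 'I_4) (r t : R).

(** The hypotheses bound [h] from above only, and only at points where the potential is finite;
    hence the detour through an integral of the positive part of [h], which the mean value formula
    at the origin turns into a bound for the integral of its absolute value. Polynomial weights
    replace means over balls because they are compactly supported functions on the whole space:
    Green's identity reduces to Fubini and the fundamental theorem of calculus on lines, without
    surface integrals, and their masses are only estimated up to constants. The exponents 4 and 5
    are the smallest consecutive ones whose weights keep continuous third derivatives. Power
    counting: A_k has mass of order r^(2k+4) and third derivatives of order r^(2k-3), which gives
    r^-7 times the integral of |h| near the origin, or r^-9 once the weight A, of order r^2 there,
    is inserted. The bound r^8 is the mass r^6 of A times the Laplacian term r^2 of the mean value
    formula. One power of r is left over, and the linear bound for h^+ contributes only r^7, so a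
    crude bound of the logarithm is affordable. *)

Lemma ord4P (P : 'I_4 -> Prop) :
  P (inord 0) -> P (inord 1) -> P (inord 2) -> P (inord 3) -> forall i, P i.
Proof.
move=> P0 P1 P2 P3 i; rewrite -(inord_val i).
by case: i => -[|[|[|[|//]]]].
Qed.

Lemma coord4_inord x : (coord4 x (inord 0) = x.1.1) * (coord4 x (inord 1) = x.1.2) *
  (coord4 x (inord 2) = x.2.1) * (coord4 x (inord 3) = x.2.2).
Proof. by rewrite /coord4 /= !inordK. Qed.

Lemma sum_ord4 (V : nmodType) (F : 'I_4 -> V) :
  \sum_(i < 4) F i = F (inord 0) + F (inord 1) + F (inord 2) + F (inord 3).
Proof.
rewrite !big_ord_recr big_ord0 /= add0r; do ! congr (_ + _); congr F;
  by apply/val_inj; rewrite /= inordK.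
Qed.

Lemma eq_pt4 x y : (forall i, coord4 x i = coord4 y i) -> x = y.
Proof.
move=> xy; move: (xy (inord 0)) (xy (inord 1)) (xy (inord 2)) (xy (inord 3)).
rewrite !coord4_inord; case: x {xy} => -[? ?] [? ?]; case: y => -[? ?] [? ?] /=.
by move=> -> -> -> ->.
Qed.

Lemma coord4_mkpt4 (f : 'I_4 -> R) i : coord4 (mkpt4 f) i = f i.
Proof. by move: i; apply: ord4P; rewrite coord4_inord. Qed.

Lemma coord4D x y i : coord4 (x + y) i = coord4 x i + coord4 y i.
Proof. by move: i; apply: ord4P; rewrite !coord4_inord. Qed.

Lemma coord4B x y i : coord4 (x - y) i = coord4 x i - coord4 y i.
Proof. by move: i; apply: ord4P; rewrite !coord4_inord. Qed.

Lemma coord4Z t x i : coord4 (t *: x) i = t * coord4 x i.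
Proof. by move: i; apply: ord4P; rewrite !coord4_inord. Qed.

Definition e4 i : pt4 R := mkpt4 (fun j => (j == i)%:R).

Lemma coord4e i j : coord4 (e4 i) j = (j == i)%:R.
Proof. exact: coord4_mkpt4. Qed.

Lemma addcoord4E x i t : addcoord4 x i t = x + t *: e4 i.
Proof.
apply: eq_pt4 => j; rewrite coord4_mkpt4 coord4D coord4Z coord4e.
by case: eqP => _; rewrite ?mulr1 ?mulr0.
Qed.

Lemma mkpt40 : mkpt4 (fun=> 0) = 0 :> pt4 R.
Proof. by apply: eq_pt4 => j; rewrite coord4_mkpt4. Qed.

Lemma continuous_coord4 i : continuous (fun x => coord4 x i).
Proof.
move: i; apply: ord4P => x; rewrite /continuous_at;
  under eq_fun do rewrite coord4_inord; rewrite coord4_inord.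
- by apply: (@cvg_comp _ _ _ fst fst); [exact: cvg_fst|exact: cvg_fst].
- by apply: (@cvg_comp _ _ _ fst snd); [exact: cvg_fst|exact: cvg_snd].
- by apply: (@cvg_comp _ _ _ snd fst); [exact: cvg_snd|exact: cvg_fst].
- by apply: (@cvg_comp _ _ _ snd snd); [exact: cvg_snd|exact: cvg_snd].
Qed.

(** The Euclidean norm without its square root, so that kernels built from it are polynomial on
    their support. *)
Definition sq4 x : R := \sum_(i < 4) coord4 x i ^+ 2.

Lemma sq4_ge0 x : 0 <= sq4 x.
Proof. by apply: sumr_ge0 => i _; exact: sqr_ge0. Qed.

Lemma enorm4E x : enorm4 x = Num.sqrt (sq4 x).
Proof. by []. Qed.

Lemma edist4E x y : edist4 x y = Num.sqrt (sq4 (x - y)).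
Proof.
by rewrite /edist4 /sq4; congr Num.sqrt; apply: eq_bigr => i _; rewrite coord4B.
Qed.

Lemma continuous_sq4 : continuous sq4.
Proof.
have -> : sq4 = fun x => coord4 x (inord 0) * coord4 x (inord 0) +
    coord4 x (inord 1) * coord4 x (inord 1) + coord4 x (inord 2) * coord4 x (inord 2) +
    coord4 x (inord 3) * coord4 x (inord 3).
  by apply/funext => x; rewrite /sq4 sum_ord4 !expr2.
move=> x; apply: cvgD; first apply: cvgD; first apply: cvgD;
  by apply: cvgM; exact: continuous_coord4.
Qed.

(** The norm of the product type is the sup norm. Its balls are boxes, convenient for compactness
    and volume, while the theorem and the kernels use the Euclidean norm [enorm4]; the two differ by
    a factor of at most 2. *)
Lemma norm_pt4 x : `|x| = Num.max (Num.max `|x.1.1| `|x.1.2|) (Num.max `|x.2.1| `|x.2.2|).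
Proof. by []. Qed.

Lemma norm_pt4_le x r : (`|x| <= r) = [forall i, `|coord4 x i| <= r].
Proof.
rewrite norm_pt4 !ge_max; apply/idP/forallP => [|h].
  by move=> /andP[/andP[? ?] /andP[? ?]]; apply: ord4P; rewrite coord4_inord.
move: (h (inord 0)) (h (inord 1)) (h (inord 2)) (h (inord 3)).
by rewrite !coord4_inord => -> -> -> ->.
Qed.

Lemma coord4_le x i : `|coord4 x i| <= `|x|.
Proof. by have := lexx `|x|; rewrite norm_pt4_le => /forallP/(_ i). Qed.

Lemma sqr_coord4_le x i : coord4 x i ^+ 2 <= sq4 x.
Proof.
by rewrite /sq4 (bigD1 i)//= lerDl; apply: sumr_ge0 => j _; exact: sqr_ge0.
Qed.

Lemma norm_pt4_enorm4 x : `|x| <= enorm4 x.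
Proof.
rewrite norm_pt4_le; apply/forallP => i.
by rewrite -sqrtr_sqr enorm4E ler_wsqrtr// sqr_coord4_le.
Qed.

Lemma sqr_norm_pt4 x : `|x| ^+ 2 <= sq4 x.
Proof.
rewrite -[leRHS]sqr_sqrtr ?sq4_ge0// -enorm4E ler_sqr ?nnegrE//.
  exact: norm_pt4_enorm4.
exact: sqrtr_ge0.
Qed.

Lemma sq4_le x : sq4 x <= 4 * `|x| ^+ 2.
Proof.
have h i : coord4 x i ^+ 2 <= `|x| ^+ 2.
  by rewrite -(real_normK (num_real (coord4 x i))) ler_sqr ?nnegrE// coord4_le.
rewrite /sq4 sum_ord4.
by have := h (inord 0); have := h (inord 1); have := h (inord 2); have := h (inord 3); lra.
Qed.

Lemma enorm4_le x : enorm4 x <= 2 * `|x|.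
Proof.
rewrite enorm4E -[leRHS]ger0_norm ?mulr_ge0// -sqrtr_sqr ler_wsqrtr//.
by apply: le_trans (sq4_le x) _; rewrite exprMn -natrX.
Qed.

Lemma normeE i : `|e4 i| = 1.
Proof.
apply/eqP; rewrite eq_le; apply/andP; split.
  rewrite norm_pt4_le; apply/forallP => j; rewrite coord4e.
  by case: eqP; rewrite /= ?normr0 ?normr1.
by have := coord4_le (e4 i) i; rewrite coord4e eqxx normr1.
Qed.

End coordinates.

(** * Integration over R^4 *)

Lemma integrable_bounded_on (R : realType) d (T : measurableType d)
    (m : {measure set T -> \bar R}) (B : set T) (f : T -> R) (M : R) :
  measurable B -> (m B < +oo)%E -> measurable_fun setT f ->
  (forall x, `|f x| <= M) -> (forall x, ~ B x -> f x = 0) ->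
  m.-integrable setT (EFin \o f).
Proof.
move=> mB Bfin mf fM f0.
have -> : f = f \_ B.
  by apply/funext => x; rewrite patchE; case: ifPn => // /negP xb; rewrite f0// => /mem_set.
rewrite -restrict_EFin; apply/integrable_restrict => //; rewrite setTI.
apply: measurable_bounded_integrable => //; first exact: measurable_funS mf.
by exists M; split; rewrite ?num_real// => N MN x _; exact: le_trans (fM _) (ltW MN).
Qed.

Section measure4.
Variable R : realType.
Implicit Types (x y : pt4 R) (i j : 'I_4) (r t : R).
Notation mu := (@leb4 R).

(* [R] carries two convertible measurable structures whose displays differ; [mpt4]
   fixes the one used by [leb4]. *)
Definition mpt4 : measurableType _ :=
  ((measurableTypeR R * measurableTypeR R) * (measurableTypeR R * measurableTypeR R))%type.

Lemma lebesgue2_square (r : R) : 0 <= r ->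
  (@lebesgue_measure R \x @lebesgue_measure R)%E (`[-r, r]%classic `*` `[-r, r]%classic) =
  ((2 * r) ^+ 2)%:E.
Proof.
move=> r0; rewrite product_measure1E//= lebesgue_measure_itv/= lte_fin.
have [rr|rr] := ltP (-r) r.
  by rewrite -EFinD -!EFinM; congr EFin; ring.
have -> : r = 0 by lra.
by rewrite mule0 mulr0 expr0n.
Qed.

Lemma bigcup_itvNnn : \bigcup_n `[-n%:R, n%:R]%classic = [set: R].
Proof.
rewrite -subTset => x _; exists (Num.bound `|x|) => //=.
by rewrite in_itv/= -ler_norml ltW// archi_boundP.
Qed.

Lemma lebesgue2_sigma_finite :
  sigma_finite setT (@lebesgue_measure R \x @lebesgue_measure R)%E.
Proof.
exists (fun n => `[-n%:R, n%:R]%classic `*` `[-n%:R, n%:R]%classic) => [|n].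
  apply/esym; rewrite -subTset => -[x y] _.
  have [n _ xn] : (\bigcup_n `[-n%:R, n%:R]%classic) x by rewrite bigcup_itvNnn.
  have [m _ ym] : (\bigcup_n `[-n%:R, n%:R]%classic) y by rewrite bigcup_itvNnn.
  exists (maxn n m) => //; split; [move: xn|move: ym]; rewrite /= !in_itv/= -!ler_norml;
    by move=> /le_trans; apply; rewrite ler_nat ?leq_maxl ?leq_maxr.
by split; [exact: measurableX|rewrite lebesgue2_square ?ltry].
Qed.

(* The library declares no sigma-finiteness instance for general product measures. *)
Definition leb2 : {sigma_finite_measure set _ -> \bar R} :=
  HB.pack (@lebesgue_measure R \x @lebesgue_measure R)%E
    (@Measure_isSigmaFinite.Build _ _ R (@lebesgue_measure R \x @lebesgue_measure R)%E
      lebesgue2_sigma_finite).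

Lemma measurable_ball_pt4 x r : measurable (ball x r : set mpt4).
Proof.
have -> : ball x r = (ball x.1.1 r `*` ball x.1.2 r) `*` (ball x.2.1 r `*` ball x.2.2 r).
  by rewrite eqEsubset; split => y.
by apply: measurableX; apply: measurableX; exact: measurable_ball.
Qed.

(** The sigma-algebra of [mpt4] is generated by rectangles, so open sets need an argument: [U] is
    the union of the countably many sup balls with rational centre and radius 1/(n+1) that it
    contains. *)
Lemma open_measurable_pt4 (U : set (pt4 R)) : open U -> measurable (U : set mpt4).
Proof.
move=> oU.
pose q4 (q : (rat * rat) * (rat * rat)) : pt4 R :=
  ((ratr q.1.1, ratr q.1.2), (ratr q.2.1, ratr q.2.2)).
pose F (p : ((rat * rat) * (rat * rat)) * nat) : set (pt4 R) :=
  [set y | ball (q4 p.1) p.2.+1%:R^-1 y /\ ball (q4 p.1) p.2.+1%:R^-1 `<=` U].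
have mF p : measurable (F p : set mpt4).
  have [sU|sU] := pselect (ball (q4 p.1) p.2.+1%:R^-1 `<=` U).
    have -> : F p = ball (q4 p.1) p.2.+1%:R^-1 by rewrite eqEsubset; split => y // -[].
    exact: measurable_ball_pt4.
  have -> : F p = set0 by rewrite eqEsubset; split => y // -[].
  exact: measurable0.
suff -> : U = \bigcup_p F p by apply: countable_bigcupT_measurable.
rewrite eqEsubset; split => [x Ux|x [p _ [] + +]]; last by move=> ? ; apply.
have [e /= e0 xeU] : nbhs_ball x U by apply/nbhs_ballP; exact: oU.
(* Half of [e]: the rational centre lies within 1/(n+1) of [x] and its ball has that same radius, so
   the ball stays within [e] of [x]. *)
have [n nlt] : exists n, n.+1%:R^-1 < e / 2.
  have [k _ hk] := near_infty_natSinv_lt (PosNum (divr_gt0 e0 (ltr0n _ 2))).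
  by exists k; exact: (hk k (leqnn k)).
have n0 : 0 < n.+1%:R^-1 :> R by rewrite invr_gt0.
have qx (d s : R) : 0 < d -> exists q : rat, `|ratr q - s| < d.
  move=> d0; have [|q] := @rat_in_itvoo _ (s - d) (s + d); first lra.
  by rewrite in_itv/= => /andP[? ?]; exists q; rewrite ltr_norml; apply/andP; split; lra.
have [q1 h1] := qx _ x.1.1 n0; have [q2 h2] := qx _ x.1.2 n0.
have [q3 h3] := qx _ x.2.1 n0; have [q4' h4] := qx _ x.2.2 n0.
exists (((q1, q2), (q3, q4')), n) => //; split => /=.
  by split; split.
move: (n.+1%:R^-1) nlt n0 h1 h2 h3 h4 => d nlt n0 h1 h2 h3 h4 y [[y1 y2] [y3 y4]]; apply: xeU;
  split; split;
  rewrite /ball /= /ball_ /= in y1 y2 y3 y4 h1 h2 h3 h4 *; rewrite /q4 /= in y1 y2 y3 y4;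
  [move: y1 h1|move: y2 h2|move: y3 h3|move: y4 h4]; rewrite !ltr_norml => /andP[? ?] /andP[? ?];
  apply/andP; split; lra.
Qed.

Lemma continuous_measurable_pt4 (f : pt4 R -> R) : continuous f -> measurable_fun [set: mpt4] f.
Proof.
move=> /continuousP cf; apply: (measurability _ (RGenOpens.measurableE R)).
move=> _ [_ [a [b ->] <-]]; rewrite setTI; apply: open_measurable_pt4.
exact/cf/interval_open.
Qed.

Definition box (r : R) : set (pt4 R) :=
  (`[-r, r] `*` `[-r, r]) `*` (`[-r, r] `*` `[-r, r]).

Lemma boxP r x : box r x <-> `|x| <= r.
Proof.
rewrite norm_pt4 !ge_max; rewrite /box /= !in_itv/= -!ler_norml; split.
  by move=> [[-> ->] [-> ->]].
by move=> /andP[/andP[? ?] /andP[? ?]].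
Qed.

Lemma measurable_box r : measurable (box r : set mpt4).
Proof. by apply: measurableX; apply: measurableX. Qed.

Lemma compact_box r : compact (box r).
Proof. by apply: compact_setX; apply: compact_setX; exact: segment_compact. Qed.

Lemma leb4_box r : 0 <= r -> mu (box r) = ((2 * r) ^+ 4)%:E.
Proof.
move=> r0; rewrite -[LHS]/((leb2 \x leb2)%E (box r)) /box.
rewrite product_measure1E; try exact: measurableX.
have E : leb2 (`[-r, r]%classic `*` `[-r, r]%classic) = ((2 * r) ^+ 2)%:E := lebesgue2_square r0.
by rewrite [X in (X * _)%E]E [X in (_ * X)%E]E -EFinM; congr EFin; ring.
Qed.

Lemma leb4_sigma_finite : sigma_finite setT (leb2 \x leb2)%E.
Proof.
exists (fun n => box n%:R) => [|n].
  apply/esym; rewrite -subTset => x _;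
    have [n _ xn] : (\bigcup_n `[-n%:R, n%:R]%classic) `|x| by rewrite bigcup_itvNnn.
  exists n => //; apply/boxP; move: xn; rewrite /= in_itv/= => /andP[_].
  exact.
split; first exact: measurable_box.
by rewrite -[X in (X < _)%E]/(mu (box n%:R)) leb4_box// ltry.
Qed.

(** The measure [leb4] packed with the sigma-finiteness that Fubini and Tonelli require. The two are
    convertible, so hypotheses about [leb4] transfer by typing alone. *)
Definition leb4s : {sigma_finite_measure set _ -> \bar R} :=
  HB.pack (leb2 \x leb2)%E
    (@Measure_isSigmaFinite.Build _ _ R (leb2 \x leb2)%E leb4_sigma_finite).

Lemma integrable_bounded_box (f : pt4 R -> R) r (M : R) : measurable_fun [set: mpt4] f ->
  (forall x, `|f x| <= M) -> (forall x, r < `|x| -> f x = 0) ->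
  leb4s.-integrable setT (EFin \o f).
Proof.
move=> mf fM f0.
have f0' x : ~ box (Num.max r 0) x -> f x = 0.
  by move=> xb; rewrite f0// ltNge; apply/negP => xr; apply/xb/boxP; rewrite le_max xr.
have fin : (mu (box (Num.max r 0)%R) < +oo)%E by rewrite leb4_box ?ltry// le_max lexx orbT.
exact: (@integrable_bounded_on _ _ mpt4 leb4s _ f M (measurable_box _) fin mf fM f0').
Qed.

Lemma continuous_box_bounded (f : pt4 R -> R) r : continuous f ->
  exists2 M, 0 <= M & forall x, `|x| <= r -> `|f x| <= M.
Proof.
move=> cf.
have /compact_bounded[M [_ hM]] : compact (f @` box r).
  apply: continuous_compact; last exact: compact_box.
  exact: continuous_subspaceT.
exists (Num.max (M + 1) 0) => [|x /boxP xr]; first by rewrite le_max lexx orbT.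
apply: (hM (Num.max (M + 1) 0)); first by rewrite lt_max ltrDl ltr01.
by exists x.
Qed.

Lemma cc_bounded (f : pt4 R -> R) r : continuous f -> (forall x, r < `|x| -> f x = 0) ->
  exists2 M, 0 <= M & forall x, `|f x| <= M.
Proof.
move=> cf f0; have [M M0 hM] := continuous_box_bounded r cf.
exists M => // x; have [/hM//|/f0 ->] := leP `|x| r.
by rewrite normr0.
Qed.

Lemma cc_integrable (f : pt4 R -> R) r : continuous f -> (forall x, r < `|x| -> f x = 0) ->
  leb4s.-integrable setT (EFin \o f).
Proof.
move=> cf f0; have [M _ hM] := cc_bounded cf f0.
exact: (@integrable_bounded_box f r M (continuous_measurable_pt4 cf)).
Qed.

End measure4.

(** * Translation invariance of the measure *)

Section translation.
Variable R : realType.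

(** By uniqueness of Lebesgue measure: the pushforward under the shift agrees with it on half-open
    intervals. *)
Lemma lebesgue_measure_shift (a : R) (A : set (measurableTypeR R)) : measurable A ->
  @lebesgue_measure R ((fun x => x + a) @^-1` A) = lebesgue_measure A.
Proof.
have mphi : measurable_fun [set: measurableTypeR R] (fun x : R => x + a : measurableTypeR R).
  by apply: continuous_measurable_fun => x; apply: cvgD; [exact: cvg_id|exact: cvg_cst].
move=> mA; apply/esym.
pose mphi_mixin := isMeasurableFun.Build _ _ _ _ _ mphi.
pose phi : {mfun measurableTypeR R >-> measurableTypeR R} :=
  HB.pack (fun x : R => x + a : measurableTypeR R) mphi_mixin.
have : measurable A by [].
move: A {mA}; apply: (@lebesgue_measure_unique R (pushforward lebesgue_measure phi)) =>
  X [[x y] /= _ <-].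
rewrite /pushforward.
have -> : phi @^-1` `]x, y]%classic = `]x - a, y - a]%classic.
  apply/seteqP; split=> z /=; rewrite !in_itv/= => /andP[? ?]; apply/andP; split; lra.
rewrite !lebesgue_measure_itv/= !lte_fin.
have -> : (x - a < y - a) = (x < y) by rewrite ltrD2r.
by case: ifP => // _; rewrite -!EFinB; congr EFin; ring.
Qed.

(** By uniqueness of the product measure, checked on rectangles. Applied twice, it lifts shift
    invariance from the line to the plane and then to dimension four. *)
Lemma product_measure1_preimage d1 d2 (T1 : measurableType d1) (T2 : measurableType d2)
  (m1 : {sigma_finite_measure set T1 -> \bar R}) (m2 : {sigma_finite_measure set T2 -> \bar R})
  (f : T1 -> T1) (g : T2 -> T2) :
  measurable_fun setT f -> measurable_fun setT g ->
  (forall A, measurable A -> m1 (f @^-1` A) = m1 A) ->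
  (forall A, measurable A -> m2 (g @^-1` A) = m2 A) ->
  forall A, measurable A ->
  (m1 \x m2)%E ((fun x => (f x.1, g x.2)) @^-1` A) = (m1 \x m2)%E A.
Proof.
move=> mf mg fm gm A mA; apply/esym.
have mh : measurable_fun setT (fun x => (f x.1, g x.2)).
  by apply: measurable_fun_pair; apply: measurableT_comp.
pose mh_mixin := isMeasurableFun.Build _ _ _ _ _ mh.
pose h : {mfun _ >-> _} := HB.pack (fun x => (f x.1, g x.2)) mh_mixin.
apply: (@product_measure_unique _ _ _ _ _ m1 m2 (pushforward (m1 \x m2)%E h)) => //.
move=> B C mB mC; rewrite -(fm B)// -(gm C)// -product_measure1E//.
  by rewrite -[X in measurable X]setTI; exact: mf.
by rewrite -[X in measurable X]setTI; exact: mg.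
Qed.

Lemma measurable_shift (a : R) :
  measurable_fun [set: measurableTypeR R] (fun x : R => x + a : measurableTypeR R).
Proof.
by apply: continuous_measurable_fun => x; apply: cvgD; [exact: cvg_id|exact: cvg_cst].
Qed.

Lemma measurable_shift2 (s t : R) :
  measurable_fun [set: (measurableTypeR R * measurableTypeR R)%type]
    (fun x => (x.1 + s, x.2 + t) : (measurableTypeR R * measurableTypeR R)%type).
Proof. by apply: measurable_fun_pair; apply: (measurableT_comp (measurable_shift _)). Qed.

Lemma leb2_shift (s t : R) (A : set (measurableTypeR R * measurableTypeR R)) : measurable A ->
  @leb2 R ((fun x => (x.1 + s, x.2 + t)) @^-1` A) = @leb2 R A.
Proof.
exact: (@product_measure1_preimage _ _ _ _ (@lebesgue_measure R) (@lebesgue_measure R)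
  _ _ (measurable_shift s) (measurable_shift t) (lebesgue_measure_shift _)
    (lebesgue_measure_shift _)).
Qed.

Lemma leb4_shift (a : pt4 R) (A : set (mpt4 R)) : measurable A ->
  @leb4s R ((fun x => x + a) @^-1` A) = @leb4s R A.
Proof.
exact: (@product_measure1_preimage _ _ _ _ (leb2 R) (leb2 R)
  _ _ (measurable_shift2 _ _) (measurable_shift2 _ _) (leb2_shift _ _) (leb2_shift _ _)).
Qed.

Lemma ge0_integral_shift (a : pt4 R) (f : pt4 R -> \bar R) : measurable_fun [set: mpt4 R] f ->
  (forall x, 0 <= f x)%E ->
  (\int[leb4s R]_x f (x + a)%R = \int[leb4s R]_x f x)%E.
Proof.
move=> mf f0.
have mS : measurable_fun [set: mpt4 R] (fun x : pt4 R => x + a : mpt4 R).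
  apply: (@measurable_fun_pair _ _ _ _ _ _ (fun x : pt4 R => (x.1.1 + a.1.1, x.1.2 + a.1.2))
    (fun x : pt4 R => (x.2.1 + a.2.1, x.2.2 + a.2.2))).
    exact: (measurableT_comp (measurable_shift2 _ _)).
  exact: (measurableT_comp (measurable_shift2 _ _)).
have H := @ge0_integral_pushforward _ _ (mpt4 R) (mpt4 R) R _ mS (leb4s R) setT f measurableT mf.
have f0' : {in [set: mpt4 R], forall y, (0 <= f y)%E} by move=> y _; exact: f0.
move: (H f0') => {}H.
refine (etrans (esym H) _).
apply: (@eq_measure_integral _ (mpt4 R) R setT (leb4s R)
  (measure_function_pushforward__canonical__measure_function_Measure (leb4s R) mS)).
by move=> B mB _; exact: leb4_shift.
Qed.
End translation.

(** * Partial derivatives and integration by parts *)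

Section partial.
Variable R : realType.
Implicit Types (x y : pt4 R) (i j : 'I_4) (r t : R) (f g : pt4 R -> R).

(** A relation rather than the operator [dpart4]: it asserts existence and value together, so
    derivatives of explicit formulas are obtained by composing rules and adjusting the result with
    [eq_partial]. *)
Definition partial i f f' := forall x,
  is_derive (0 : R) (1 : R) (fun t => f (x + t *: e4 R i)) (f' x).

Lemma partial_at i f f' x t : partial i f f' ->
  is_derive t (1 : R) (fun s => f (x + s *: e4 R i)) (f' (x + t *: e4 R i)).
Proof.
move=> /(_ (x + t *: e4 R i)) h.
have -> : (fun s => f (x + s *: e4 R i)) =
    (fun s => f (x + t *: e4 R i + s *: e4 R i)) \o (shift (- t)).
  by apply/funext => s /=; rewrite -addrA -scalerDl (_ : t + (s - t) = s)//; ring.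
rewrite -[f' _]mulr1.
apply: (@is_derive1_comp R (fun s => f (x + t *: e4 R i + s *: e4 R i)) (shift (- t))).
  by rewrite /= subrr; exact: h.
exact: is_derive_shift.
Qed.

Lemma partial_dpart4 i f : (forall x, derivable (fun t => f (addcoord4 x i t)) 0 1) ->
  partial i f (dpart4 i f).
Proof.
move=> h x; rewrite /dpart4 derive1E.
under [in X in is_derive _ _ _ X]eq_fun do rewrite addcoord4E.
apply: DeriveDef => //; have := h x.
by under eq_fun do rewrite addcoord4E.
Qed.

Lemma partialE i f f' : partial i f f' -> dpart4 i f = f'.
Proof.
move=> h; apply/funext => x; rewrite /dpart4 derive1E.
under eq_fun do rewrite addcoord4E.
by have := h x => /@derive_val.
Qed.

Lemma eq_partial i f g f' g' : f =1 g -> f' =1 g' -> partial i f f' -> partial i g g'.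
Proof. by move=> /funext -> /funext ->. Qed.

Lemma partialD i f g f' g' : partial i f f' -> partial i g g' ->
  partial i (fun x => f x + g x) (fun x => f' x + g' x).
Proof. by move=> hf hg x; apply: is_deriveD. Qed.

Lemma partialB i f g f' g' : partial i f f' -> partial i g g' ->
  partial i (fun x => f x - g x) (fun x => f' x - g' x).
Proof. by move=> hf hg x; apply: is_deriveB. Qed.

Lemma partialM i f g f' g' : partial i f f' -> partial i g g' ->
  partial i (fun x => f x * g x) (fun x => f x * g' x + f' x * g x).
Proof.
move=> hf hg x; apply: is_derive_eq; first exact: (is_deriveM (hf x) (hg x)).
by rewrite /= scale0r addr0 /GRing.scale/=; ring.
Qed.

Lemma partial_cst i (c : R) : partial i (fun=> c) (fun=> 0).
Proof. by move=> x; exact: is_derive_cst. Qed.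

Lemma partial_comp i f f' (u u' : R -> R) : partial i f f' ->
  (forall s : R, is_derive s (1 : R) u (u' s)) ->
  partial i (fun x => u (f x)) (fun x => u' (f x) * f' x).
Proof.
move=> hf hu x.
have := @is_derive1_comp R u (fun t => f (x + t *: e4 R i)) 0 (u' (f x)) (f' x).
by apply; rewrite ?scale0r ?addr0.
Qed.

Lemma partial_shift i f f' y : partial i f f' ->
  partial i (fun x => f (x + y)) (fun x => f' (x + y)).
Proof.
move=> hf x; have := hf (x + y).
by under eq_fun do rewrite addrAC.
Qed.

Lemma partial_coord4 i j : partial i (fun x => coord4 x j) (fun=> (j == i)%:R).
Proof.
move=> x; under eq_fun do rewrite coord4D coord4Z coord4e.
apply: is_derive_eq.
by rewrite /GRing.scale/=; ring.
Qed.

Lemma partial_sq4 i : partial i (@sq4 R) (fun x => 2 * coord4 x i).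
Proof.
have h j : partial i (fun x => coord4 x j ^+ 2) (fun x => 2 * coord4 x j * (j == i)%:R).
  apply: eq_partial (partialM (partial_coord4 i j) (partial_coord4 i j)) => x /=; ring.
have := partialD (partialD (partialD (h (inord 0)) (h (inord 1))) (h (inord 2))) (h (inord 3)).
apply: eq_partial => x; first by rewrite /sq4 sum_ord4.
rewrite -(sum_ord4 (fun j => 2 * coord4 x j * (j == i)%:R)) (bigD1 i)//= eqxx mulr1.
by rewrite big1 ?addr0// => j /negbTE ->; rewrite mulr0.
Qed.

Lemma partial_MVT i f f' x t : partial i f f' ->
  exists s, `|s| <= `|t| /\ f (x + t *: e4 R i) - f x = f' (x + s *: e4 R i) * t.
Proof.
move=> hf; pose F s := f (x + s *: e4 R i).
have dF s : is_derive s (1 : R) F (f' (x + s *: e4 R i)) by exact: partial_at.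
have cF (a b : R) : {within `[a, b], continuous F}.
  apply: derivable_within_continuous => s _; exact: ex_derive.
have F0 : F 0 = f x by rewrite /F scale0r addr0.
have [t0|t0|->] := ltgtP t 0; last by exists 0; rewrite scale0r addr0 subrr mulr0.
  have [s + E] := MVT t0 (fun s _ => dF s) (cF _ _).
  rewrite in_itv/= => /andP[ts s0]; exists s; split.
    by rewrite !ltr0_norm// lerN2 ltW.
  by move: E; rewrite F0 /F => E; rewrite -opprB E; ring.
have [s + E] := MVT t0 (fun s _ => dF s) (cF _ _).
rewrite in_itv/= => /andP[s0 st]; exists s; split.
  by rewrite !gtr0_norm// ltW.
by move: E; rewrite F0 /F => ->; rewrite subr0.
Qed.

End partial.

Section ibp.
Variable R : realType.
Implicit Types (x y : pt4 R) (i j : 'I_4) (r t : R) (f g : pt4 R -> R).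

Lemma decomp_e4 x : x = coord4 x (inord 0) *: e4 R (inord 0) + coord4 x (inord 1)
  *: e4 R (inord 1) +
  coord4 x (inord 2) *: e4 R (inord 2) + coord4 x (inord 3) *: e4 R (inord 3).
Proof.
apply: eq_pt4; apply: ord4P; rewrite !coord4D !coord4Z !coord4e -!val_eqE /= !inordK//=;
  by rewrite ?mulr1 ?mulr0 ?addr0 ?add0r.
Qed.

Lemma partial_increment i f f' x t (M r : R) : partial i f f' ->
  (forall y, `|y| <= r -> `|f' y| <= M) -> `|x| + `|t| <= r ->
  `|f (x + t *: e4 R i) - f x| <= M * `|t|.
Proof.
move=> hf hM xr; have [s [st ->]] := partial_MVT x t hf.
rewrite normrM ler_wpM2r// hM//; apply: le_trans (ler_normD _ _) _.
rewrite normrZ normeE mulr1; apply: le_trans xr; lra.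
Qed.

(** Changing one coordinate at a time and applying the mean value theorem to each change makes [f]
    locally Lipschitz. This is what recovers continuity from [Ck4], whose successor clause mentions
    only partial derivatives. *)
Lemma partial_continuous f (f' : 'I_4 -> pt4 R -> R) : (forall i, partial i f (f' i)) ->
  (forall i, continuous (f' i)) -> continuous f.
Proof.
move=> hf cf' x.
(* The path from [x] to [x + d] changes four coordinates by at most 1 each, hence the margin 4. *)
have [M M0 hM] : exists2 M, 0 <= M & forall i y, `|y| <= `|x| + 4 -> `|f' i y| <= M.
  have hb i := continuous_box_bounded (`|x| + 4) (cf' i).
  have [M0 M00 h0] := hb (inord 0); have [M1 M10 h1] := hb (inord 1).
  have [M2 M20 h2] := hb (inord 2); have [M3 M30 h3] := hb (inord 3).
  exists (M0 + M1 + M2 + M3); first lra.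
  by apply: ord4P => y yx; [have := h0 _ yx|have := h1 _ yx|have := h2 _ yx|have := h3 _ yx]; lra.
have bnd d : `|d| <= 1 -> `|f (x + d) - f x| <= 4 * M * `|d|.
  move=> d1.
  set d_ := fun k => coord4 d (inord k).
  pose x0 := x + d_ 0 *: e4 R (inord 0).
  pose x1 := x0 + d_ 1 *: e4 R (inord 1).
  pose x2 := x1 + d_ 2 *: e4 R (inord 2).
  have dk k : `|d_ k| <= `|d| by exact: coord4_le.
  have nD y t i : `|y + t *: e4 R i| <= `|y| + `|t|.
    by apply: le_trans (ler_normD _ _) _; rewrite normrZ normeE mulr1.
  have n0 : `|x0| <= `|x| + `|d_ 0| by exact: nD.
  have n1 : `|x1| <= `|x0| + `|d_ 1| by exact: nD.
  have n2 : `|x2| <= `|x1| + `|d_ 2| by exact: nD.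
  have := dk 0%N; have := dk 1%N; have := dk 2%N; have := dk 3%N => k3 k2 k1 k0.
  have B y k : `|y| + `|d_ k| <= `|x| + 4 ->
      `|f (y + d_ k *: e4 R (inord k)) - f y| <= M * `|d|.
    move=> yx; apply: le_trans (partial_increment (hf _) (hM _) yx) _.
    by rewrite ler_wpM2l.
  have B0 := B x 0%N ltac:(lra); have B1 := B x0 1%N ltac:(lra).
  have B2 := B x1 2%N ltac:(lra); have B3 := B x2 3%N ltac:(lra).
  rewrite [X in x + X]decomp_e4 !addrA -[x + _ + _ + _ + _]/(x2 + d_ 3 *: e4 R (inord 3)).
  move: B0 B1 B2 B3; rewrite -/x0 -/x1 -/x2 !ler_norml =>
    /andP[? ?] /andP[? ?] /andP[? ?] /andP[? ?].
  apply/andP; split; lra.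
apply/cvgrPdist_lt => e e0; near=> y.
have yx : `|y - x| < Num.min 1 (e / (4 * M + 1)).
  by rewrite distrC; near: y; apply: cvgr_dist_lt; rewrite // lt_min ltr01 divr_gt0//; lra.
move: yx; rewrite lt_min => /andP[y1 ye].
rewrite distrC -(subrK x y) [_ - x + x]addrC.
apply: le_lt_trans (bnd _ (ltW y1)) _.
rewrite ltr_pdivlMr in ye; last lra.
by apply: le_lt_trans ye; have := normr_ge0 (y - x); nra.
Unshelve. all: by end_near. Qed.

Lemma Ck4_continuous k f : Ck4 k f -> continuous f.
Proof.
elim: k f => // k IH f [df ck].
by apply: (@partial_continuous f (fun i => dpart4 i f)) => i;
  [exact: partial_dpart4|exact: (IH _ (ck i))].
Qed.

Lemma integral_derive_cc (f f' : R -> R) (r : R) : 0 < r ->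
  (forall t, is_derive t (1 : R) f (f' t)) -> continuous f' ->
  (forall t, r <= `|t| -> f t = 0 /\ f' t = 0) ->
  (\int[@lebesgue_measure R]_t (f' t)%:E = 0)%E.
Proof.
move=> r0 df cf' f0.
have cf : continuous f.
  by move=> t; apply: differentiable_continuous; apply/derivable1_diffP; have [] := df t.
have f1 : f r = 0 by have [] := f0 r (ler_norm r).
have f2 : f (- r) = 0 by have [|//] := f0 (- r); rewrite normrN ler_norm.
have -> : (fun t => (f' t)%:E) = ((EFin \o f') \_ `[-r, r]%classic).
  apply/funext => t; rewrite patchE; case: ifPn => // /negP tr.
  rewrite (f0 t _).2//; have [//|/ltW tr'] := leP r `|t|.
  by exfalso; apply: tr; rewrite inE /= in_itv/= -ler_norml.
rewrite -integral_mkcond (@continuous_FTC2 _ f' f).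
- by rewrite f1 f2 subee.
- lra.
- exact: continuous_subspaceT.
- split => [t _||].
  + exact: ex_derive.
  + apply: cvg_at_right_filter; exact: cf.
  + apply: cvg_at_left_filter; exact: cf.
- by move=> t _; rewrite derive1E; exact: derive_val.
Qed.

Lemma integral_product0l d1 d2 (T1 : measurableType d1) (T2 : measurableType d2)
  (m1 : {sigma_finite_measure set T1 -> \bar R}) (m2 : {sigma_finite_measure set T2 -> \bar R})
  (F : T1 * T2 -> \bar R) : (m1 \x m2)%E.-integrable setT F ->
  (forall b, \int[m1]_a F (a, b) = 0)%E -> (\int[(m1 \x m2)%E]_z F z = 0)%E.
Proof.
by move=> iF F0; rewrite -integral21_prod_meas1//; apply: integral0_eq => b _; exact: F0.
Qed.

Lemma integral_product0r d1 d2 (T1 : measurableType d1) (T2 : measurableType d2)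
  (m1 : {sigma_finite_measure set T1 -> \bar R}) (m2 : {sigma_finite_measure set T2 -> \bar R})
  (F : T1 * T2 -> \bar R) : (m1 \x m2)%E.-integrable setT F ->
  (forall a, \int[m2]_b F (a, b) = 0)%E -> (\int[(m1 \x m2)%E]_z F z = 0)%E.
Proof.
by move=> iF F0; rewrite -integral12_prod_meas1//; apply: integral0_eq => a _; exact: F0.
Qed.

Lemma integrable_bounded_square (G : R * R -> R) r (M : R) :
  measurable_fun [set: (measurableTypeR R * measurableTypeR R)%type] G ->
  (forall z, `|G z| <= M) -> (forall z, r < `|z| -> G z = 0) ->
  (leb2 R).-integrable setT (EFin \o G).
Proof.
move=> mG GM G0; pose s := Num.max r 0;
  pose B : set (R * R) := `[-s, s]%classic `*` `[-s, s]%classic.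
have s0 : 0 <= s by rewrite le_max lexx orbT.
have mB : measurable (B : set (measurableTypeR R * measurableTypeR R)%type) by exact: measurableX.
have fin : (leb2 R B < +oo)%E.
  by rewrite -[X in (X < _)%E]/((lebesgue_measure \x lebesgue_measure)%E B) lebesgue2_square// ltry.
have G0' z : ~ B z -> G z = 0.
  move=> zB; apply: G0; rewrite ltNge; apply/negP => zr; apply: zB.
  have : `|z| <= s by rewrite le_max zr.
  by rewrite prod_normE ge_max !ler_norml => /andP[? ?]; split; rewrite /= in_itv/=.
exact: (@integrable_bounded_on _ _ _ (leb2 R) B G M mB fin mG GM G0').
Qed.

(** Integration by parts in its simplest form: Fubini isolates the lines in direction [i], and on
    each line the fundamental theorem gives a difference of two vanishing end values. *)
Lemma integral_partial0 i g g' r : partial i g g' -> continuous g' ->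
  (forall x, r < `|x| -> g x = 0) -> (forall x, r < `|x| -> g' x = 0) ->
  (\int[leb4s R]_x (g' x)%:E = 0)%E.
Proof.
move=> dg cg' g0 g'0.
have [M M0 hM] := cc_bounded cg' g'0.
have mg' := continuous_measurable_pt4 cg'.
have ig' : (leb2 R \x leb2 R)%E.-integrable setT (EFin \o g') by exact: cc_integrable g'0.
pose s := `|r| + 1; have s0 : 0 < s by rewrite ltr_wpDl.
(* Points are nested pairs, so each direction has its own syntactic parametrization of the line;
   [phi] abstracts over the four of them. *)
have fiber i' x (phi : R -> pt4 R) : partial i' g g' -> coord4 x i' = 0 ->
    (forall t, phi t = x + t *: e4 R i') ->
    (\int[@lebesgue_measure R]_t (g' (phi t))%:E = 0)%E.
  move=> dg' xi phiE; apply: (@integral_derive_cc (g \o phi) (g' \o phi) s) => //.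
  - move=> t /=; rewrite phiE.
    have -> : g \o phi = fun t => g (x + t *: e4 R i') by apply/funext => u /=; rewrite phiE.
    exact: partial_at.
  - move=> t; apply: continuous_comp; last exact: cg'.
    have -> : phi = fun t => x + t *: e4 R i' by apply/funext => u; rewrite phiE.
    by apply: cvgD; [exact: cvg_cst|apply: cvgZr_tmp; exact: cvg_id].
  - move=> t st.
    have rx : r < `|phi t|.
      apply: lt_le_trans (le_trans st _); first by rewrite /s ltr_pwDr// ler_norm.
      have := coord4_le (phi t) i'.
      by rewrite phiE coord4D coord4Z coord4e eqxx mulr1 xi add0r.
  by split=> /=; [rewrite g0|rewrite g'0].
have il (y : R * R) : (leb2 R).-integrable setT (EFin \o (fun z => g' (z, y))).
  apply: (@integrable_bounded_square _ r M) => [||z rz].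
  - exact: (@measurable_fun_pair1 _ _ _ (measurableTypeR R * measurableTypeR R)%type
      (measurableTypeR R * measurableTypeR R)%type R g' y mg').
  - by move=> z.
  - by apply: g'0; apply: lt_le_trans rz _; rewrite [leRHS]prod_normE le_max lexx.
have ir (y : R * R) : (leb2 R).-integrable setT (EFin \o (fun z => g' (y, z))).
  apply: (@integrable_bounded_square _ r M) => [||z rz].
  - exact: (@measurable_fun_pair2 _ _ _ (measurableTypeR R * measurableTypeR R)%type
      (measurableTypeR R * measurableTypeR R)%type R g' y mg').
  - by move=> z.
  - by apply: g'0; apply: lt_le_trans rz _; rewrite [leRHS]prod_normE le_max lexx orbT.
have F2l (y : R * R) : (forall b, \int[@lebesgue_measure R]_a (g' ((a, b), y))%:E = 0)%E ->
    (\int[leb2 R]_z (g' (z, y))%:E = 0)%E by exact: (@integral_product0l _ _ (measurableTypeR R)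
      (measurableTypeR R) (@lebesgue_measure R)
      (@lebesgue_measure R) _ (il y)).
have F2r (y : R * R) : (forall b, \int[@lebesgue_measure R]_a (g' ((b, a), y))%:E = 0)%E ->
    (\int[leb2 R]_z (g' (z, y))%:E = 0)%E by exact: (@integral_product0r _ _ (measurableTypeR R)
      (measurableTypeR R) (@lebesgue_measure R)
      (@lebesgue_measure R) _ (il y)).
have G2l (y : R * R) : (forall b, \int[@lebesgue_measure R]_a (g' (y, (a, b)))%:E = 0)%E ->
    (\int[leb2 R]_z (g' (y, z))%:E = 0)%E by exact: (@integral_product0l _ _ (measurableTypeR R)
      (measurableTypeR R) (@lebesgue_measure R)
      (@lebesgue_measure R) _ (ir y)).
have G2r (y : R * R) : (forall b, \int[@lebesgue_measure R]_a (g' (y, (b, a)))%:E = 0)%E ->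
    (\int[leb2 R]_z (g' (y, z))%:E = 0)%E by exact: (@integral_product0r _ _ (measurableTypeR R)
      (measurableTypeR R) (@lebesgue_measure R)
      (@lebesgue_measure R) _ (ir y)).
move: i dg; apply: ord4P => dg.
- apply: (integral_product0l ig') => -[y1 y2]; apply: F2l => b.
  apply: (fiber _ ((0, b), (y1, y2)) _ dg); first by rewrite coord4_inord.
  by move=> t; apply: eq_pt4; apply: ord4P;
    rewrite coord4D coord4Z coord4e !coord4_inord -!val_eqE /= !inordK//= ?mulr1 ?mulr0 ?addr0
      ?add0r.
- apply: (integral_product0l ig') => -[y1 y2]; apply: F2r => b.
  apply: (fiber _ ((b, 0), (y1, y2)) _ dg); first by rewrite coord4_inord.
  by move=> t; apply: eq_pt4; apply: ord4P;
    rewrite coord4D coord4Z coord4e !coord4_inord -!val_eqE /= !inordK//= ?mulr1 ?mulr0 ?addr0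
      ?add0r.
- apply: (integral_product0r ig') => -[y1 y2]; apply: G2l => b.
  apply: (fiber _ ((y1, y2), (0, b)) _ dg); first by rewrite coord4_inord.
  by move=> t; apply: eq_pt4; apply: ord4P;
    rewrite coord4D coord4Z coord4e !coord4_inord -!val_eqE /= !inordK//= ?mulr1 ?mulr0 ?addr0
      ?add0r.
- apply: (integral_product0r ig') => -[y1 y2]; apply: G2r => b.
  apply: (fiber _ ((y1, y2), (b, 0)) _ dg); first by rewrite coord4_inord.
  by move=> t; apply: eq_pt4; apply: ord4P;
    rewrite coord4D coord4Z coord4e !coord4_inord -!val_eqE /= !inordK//= ?mulr1 ?mulr0 ?addr0
      ?add0r.
Qed.

End ibp.

(** * Mean value formulas *)

Section positive_part_powers.
Variable R : realType.
Implicit Types (s : R).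

Lemma is_derive_quadratic (f : R -> R) (x d C : R) :
  (forall h, `|f (x + h) - f x - h * d| <= C * h ^+ 2) -> is_derive x (1 : R) f d.
Proof.
move=> fC.
have lim : h^-1 *: (f (h *: (1 : R) + x) - f x) @[h --> (0 : R)^'] --> d.
  apply/cvgrPdist_lt => e e0; near=> h.
  have h0 : h != 0 by near: h; exact: nbhs_dnbhs_neq.
  have he : `|h| < e / (`|C| + 1).
    near: h; apply: dnbhs0_lt; rewrite divr_gt0// ltr_wpDl//.
  have -> : d - h^-1 *: (f (h *: (1 : R) + x) - f x) = - h^-1 * (f (x + h) - f x - h * d).
    by rewrite /GRing.scale/= mulr1 [h + x]addrC; field.
  rewrite normrM normrN normfV mulrC ltr_pdivrMr ?normr_gt0//.
  apply: le_lt_trans (fC h) _; rewrite -(real_normK (num_real h)).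
  rewrite ltr_pdivlMr in he; last by rewrite ltr_wpDl.
  have hp : 0 < `|h| by rewrite normr_gt0.
  have := ler_norm C; nra.
by apply: DeriveDef; [apply/cvg_ex; exists d|exact: cvg_lim].
Unshelve. all: by end_near. Qed.

Definition pp s : R := Num.max s 0.

Lemma pp_ge0 s : 0 <= pp s. Proof. by rewrite /pp le_max lexx orbT. Qed.

Lemma pp_pos s : 0 <= s -> pp s = s. Proof. exact: max_l. Qed.

Lemma pp_neg s : s <= 0 -> pp s = 0. Proof. exact: max_r. Qed.

(** The positive exponent makes both sides vanish for negative [s]. This identity drives the
    derivative of powers of [pp] and also the recursion between kernels. *)
Lemma mul_pp s k : s * pp s ^+ k.+1 = pp s ^+ k.+2.
Proof.
have [s0|s0] := leP 0 s; first by rewrite pp_pos// [RHS]exprS.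
by rewrite pp_neg ?ltW// !expr0n mulr0.
Qed.

Lemma continuous_pp : continuous pp.
Proof. by move=> s; apply: continuous_max; [exact: cvg_id|exact: cvg_cst]. Qed.

(** The square is handled by a quadratic error bound with constant 1. Higher powers are written as
    [s] times the previous one, so that the product rule only meets differentiable factors. *)
Lemma is_derive_ppX k s : is_derive s (1 : R) (fun s => pp s ^+ k.+2) (k.+2%:R * pp s ^+ k.+1).
Proof.
elim: k s => [|k IH] s.
  apply: (@is_derive_quadratic _ _ _ 1) => h; rewrite expr1 mul1r.
  have [s0|s0] := leP 0 s; have [t0|t0] := leP 0 (s + h);
    rewrite ?(pp_pos s0) ?(pp_pos t0) ?(pp_neg (ltW s0)) ?(pp_neg (ltW t0)) ler_norml;
    apply/andP; split; nra.
have -> : (fun s => pp s ^+ k.+3) = (fun s => s * pp s ^+ k.+2).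
  by apply/funext => t; rewrite mul_pp.
have H : is_derive s (1 : R) (fun s => s * pp s ^+ k.+2)
    (s *: (k.+2%:R * pp s ^+ k.+1) + pp s ^+ k.+2 *: 1) := is_deriveM (is_derive_id s 1) (IH s).
have <- : s *: (k.+2%:R * pp s ^+ k.+1) + pp s ^+ k.+2 *: 1 = k.+3%:R * pp s ^+ k.+2.
  by rewrite /GRing.scale/= mulr1 mulrCA mul_pp -[in RHS]natr1; ring.
exact: H.
Qed.

End positive_part_powers.

Section compact_support.
Variable R : realType.
Implicit Types (f g : pt4 R -> R).

Definition cc f := continuous f /\ exists r : R, forall x, r < `|x| -> f x = 0.

Lemma ccM f g : continuous f -> cc g -> cc (fun x => f x * g x).
Proof.
move=> cf [cg [r g0]]; split; first by move=> x; apply: cvgM; [exact: cf|exact: cg].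
by exists r => x /g0 ->; rewrite mulr0.
Qed.

Lemma ccD f g : cc f -> cc g -> cc (fun x => f x + g x).
Proof.
move=> [cf [r f0]] [cg [s g0]]; split; first by move=> x; apply: cvgD; [exact: cf|exact: cg].
exists (Num.max r s) => x; rewrite gt_max => /andP[rx sx].
by rewrite f0// g0// addr0.
Qed.

Lemma ccB f g : cc f -> cc g -> cc (fun x => f x - g x).
Proof.
move=> [cf [r f0]] [cg [s g0]]; split; first by move=> x; apply: cvgB; [exact: cf|exact: cg].
exists (Num.max r s) => x; rewrite gt_max => /andP[rx sx].
by rewrite f0// g0// subr0.
Qed.

Lemma ccZ (c : R) f : cc f -> cc (fun x => c * f x).
Proof. by move=> ccf; apply: ccM => // x; exact: cvg_cst. Qed.

Lemma cc_norm f : cc f -> cc (fun x => `|f x|).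
Proof.
move=> [cf [r f0]]; split; first by move=> x; apply: cvg_norm; exact: cf.
by exists r => x /f0 ->; rewrite normr0.
Qed.

Lemma cc_leb4 f : cc f -> (leb4s R).-integrable setT (EFin \o f).
Proof. by move=> [cf [r f0]]; exact: cc_integrable f0. Qed.

(** A real number even when [f] is not integrable; the rules below therefore carry [cc] hypotheses,
    which guarantee integrability. *)
Definition J f : R := Rintegral (leb4s R) setT f.

Lemma JD f g : cc f -> cc g -> J (fun x => f x + g x) = J f + J g.
Proof. by move=> /cc_leb4 cf /cc_leb4 cg; exact: RintegralD. Qed.

Lemma JB f g : cc f -> cc g -> J (fun x => f x - g x) = J f - J g.
Proof. by move=> /cc_leb4 cf /cc_leb4 cg; exact: RintegralB. Qed.

Lemma JZ (c : R) f : cc f -> J (fun x => c * f x) = c * J f.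
Proof. by move=> /cc_leb4 cf; exact: RintegralZl. Qed.

Lemma le_J f g : cc f -> cc g -> (forall x, f x <= g x) -> J f <= J g.
Proof. by move=> /cc_leb4 cf /cc_leb4 cg fg; exact: le_Rintegral. Qed.

Lemma normr_J f : cc f -> `|J f| <= J (fun x => `|f x|).
Proof. by move=> /cc_leb4 cf; exact: le_normr_Rintegral. Qed.

Lemma J_EFin f : cc f -> (J f)%:E = (\int[leb4s R]_x (f x)%:E)%E.
Proof. by move=> /cc_leb4 cf; rewrite fineK//; exact: integrable_fin_num. Qed.

Lemma J_partial0 i g g' : partial i g g' -> cc g -> cc g' -> J g' = 0.
Proof.
move=> dg [_ [r g0]] [cg' [s g'0]]; rewrite /J /Rintegral.
rewrite (@integral_partial0 _ i g g' (Num.max r s))// => x; rewrite gt_max => /andP[rx sx];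
  by [exact: g0|exact: g'0].
Qed.

End compact_support.

Section kern.
Variable R : realType.
Implicit Types (x y z : pt4 R) (r : R) (k : nat).

(** The weight A_k centered at [x]. For [k = 0] it is the constant 1 and not an indicator, so
    statements that need compact support use exponents [k.+1]. *)
Definition kern k r x z : R := pp (r ^+ 2 - sq4 (z - x)) ^+ k.

Lemma continuous_kern k r x : continuous (kern k r x).
Proof.
move=> z; apply: (@continuous_comp _ _ _ (fun z => pp (r ^+ 2 - sq4 (z - x))) (fun s => s ^+ k));
  last exact: exprn_continuous.
apply: (@continuous_comp _ _ _ (fun z => r ^+ 2 - sq4 (z - x)) (@pp R)); last exact: continuous_pp.
apply: cvgB; first exact: cvg_cst.
apply: (@continuous_comp _ _ _ (fun z : pt4 R => z - x) (@sq4 R)); last exact: continuous_sq4.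
by apply: cvgB; [exact: cvg_id|exact: cvg_cst].
Qed.

Lemma kern_ge0 k r x z : 0 <= kern k r x z.
Proof. by apply: exprn_ge0; exact: pp_ge0. Qed.

Lemma kern0 k r x z : r ^+ 2 <= sq4 (z - x) -> kern k.+1 r x z = 0.
Proof. by move=> rz; rewrite /kern pp_neg ?expr0n// subr_le0. Qed.

Lemma kern_far k r x z : 0 <= r -> r <= `|z - x| -> kern k.+1 r x z = 0.
Proof.
move=> r0 rz; apply: kern0; apply: le_trans (sqr_norm_pt4 _).
by rewrite ler_sqr ?nnegrE.
Qed.

Lemma cc_kern k r x : cc (kern k.+1 r x).
Proof.
split; first exact: continuous_kern.
exists (`|r| + `|x|) => z rz.
have -> : kern k.+1 r x z = kern k.+1 `|r| x z by rewrite /kern real_normK ?num_real.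
apply: kern_far => //.
by have := lerB_dist z x; lra.
Qed.

Lemma partial_kern i k r x : partial i (kern k.+2 r x)
  (fun z => - (2 * k.+2%:R) * (coord4 (z - x) i * kern k.+1 r x z)).
Proof.
have d1 : partial i (fun z => r ^+ 2 - sq4 (z - x)) (fun z => 0 - 2 * coord4 (z - x) i).
  apply: partialB; first exact: partial_cst.
  exact: (partial_shift (- x) (@partial_sq4 R i)).
apply: eq_partial (partial_comp d1 (@is_derive_ppX R k)) => z //.
by rewrite /kern; ring.
Qed.

Lemma partial_coord4_shift i j x : partial i (fun z => coord4 (z - x) j) (fun=> (j == i)%:R).
Proof. exact: (partial_shift (- x) (@partial_coord4 R i j)). Qed.

Lemma partial_coord_kern i k r x : partial i (fun z => coord4 (z - x) i * kern k.+2 r x z)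
  (fun z => kern k.+2 r x z - (2 * k.+2%:R) * (coord4 (z - x) i ^+ 2 * kern k.+1 r x z)).
Proof.
apply: eq_partial (partialM (partial_coord4_shift i i x) (@partial_kern i k r x)) => z //.
by rewrite eqxx /=; ring.
Qed.

Lemma continuous_coord4_shift i x : continuous (fun z => coord4 (z - x) i).
Proof.
move=> z; apply: (@continuous_comp _ _ _ (fun z : pt4 R => z - x) (fun z => coord4 z i));
  last exact: continuous_coord4.
by apply: cvgB; [exact: cvg_id|exact: cvg_cst].
Qed.

(* Green's identity for [f] and [kern k.+3], whose Laplacian is the combination of
   [kern k.+1] and [kern k.+2] on the right. *)
Lemma kern_recursion k r x f (f1 f2 : 'I_4 -> pt4 R -> R) :
  (forall i, partial i f (f1 i)) -> (forall i, partial i (f1 i) (f2 i)) ->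
  continuous f -> (forall i, continuous (f1 i)) -> (forall i, continuous (f2 i)) ->
  J (fun z => (\sum_(i < 4) f2 i z) * kern k.+3 r x z) =
  4 * k.+3%:R * (k.+2%:R * r ^+ 2 * J (fun z => f z * kern k.+1 r x z)
                 - k.+4%:R * J (fun z => f z * kern k.+2 r x z)).
Proof.
move=> d1 d2 cf cf1 cf2.
pose c := (2 * k.+3%:R : R).
(* With A = [kern k.+3 r x], this is the i-th derivative of f (d_i A) - (d_i f) A, in which the
   products of first derivatives cancel; its integral is therefore zero. *)
pose g' i z := f z * (c * ((2 * k.+2%:R) * (coord4 (z - x) i ^+ 2 * kern k.+1 r x z)
  - kern k.+2 r x z))
  - f2 i z * kern k.+3 r x z.
have ccb j : cc (kern j.+1 r x) by exact: cc_kern.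
have cc1 i : cc (fun z => coord4 (z - x) i * kern k.+2 r x z).
  by apply: ccM => //; exact: continuous_coord4_shift.
have cc2 i : cc (fun z => coord4 (z - x) i ^+ 2 * kern k.+1 r x z).
  apply: ccM => // z; apply: (@continuous_comp _ _ _ (fun z => coord4 (z - x) i) (fun s => s ^+ 2)).
    exact: continuous_coord4_shift.
  exact: exprn_continuous.
have ccg' i : cc (g' i).
  apply: ccB; last exact: ccM.
  by apply: ccM => //; apply: ccZ; apply: ccB => //; apply: ccZ.
have Jg' i : J (g' i) = 0.
  apply: (@J_partial0 _ i (fun z =>
    f z * (- c * (coord4 (z - x) i * kern k.+2 r x z)) - f1 i z * kern k.+3 r x z)) => //.
    apply: eq_partial (partialB (partialM (d1 i) (partialM (partial_cst i (- c))
      (@partial_coord_kern i k r x)))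
      (partialM (d2 i) (@partial_kern i k.+1 r x))) => z //.
    by rewrite /g' /c; ring.
  apply: ccB; last exact: ccM.
  by apply: ccM => //; apply: ccZ.
have E : J (fun z => g' (inord 0) z + g' (inord 1) z + g' (inord 2) z + g' (inord 3) z) = 0.
  have c2 := ccD (ccg' (inord 0)) (ccg' (inord 1)); have c3 := ccD c2 (ccg' (inord 2)).
  by rewrite (JD c3 (ccg' _)) (JD c2 (ccg' _)) (JD (ccg' _) (ccg' _)) !Jg' !addr0.
have E2 z : g' (inord 0) z + g' (inord 1) z + g' (inord 2) z + g' (inord 3) z =
    (4 * k.+3%:R * (k.+2%:R * r ^+ 2) * (f z * kern k.+1 r x z)
     - 4 * k.+3%:R * k.+4%:R * (f z * kern k.+2 r x z))
    - (\sum_(i < 4) f2 i z) * kern k.+3 r x z.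
  (* Removes the factor |z - x|^2 from the Laplacian of the kernel. The coefficient [k.+4] arises as
     (k + 2) + 4/2, where 4 is the dimension. *)
  have Es : sq4 (z - x) * kern k.+1 r x z = r ^+ 2 * kern k.+1 r x z - kern k.+2 r x z.
    by rewrite /kern -mul_pp; ring.
  have -> : g' (inord 0) z + g' (inord 1) z + g' (inord 2) z + g' (inord 3) z =
    f z * (c * (2 * k.+2%:R * (sq4 (z - x) * kern k.+1 r x z) - 4 * kern k.+2 r x z))
      - (\sum_(i < 4) f2 i z) * kern k.+3 r x z.
    by rewrite /g' /sq4 !sum_ord4; ring.
  by rewrite Es /c -(natr1 k.+3) -(natr1 k.+2); ring.
move: E; under [X in J X]eq_fun do rewrite E2.
rewrite JB ?JB ?JZ; first by lra.
all: try by apply: ccM.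
all: try by apply: ccZ; apply: ccM.
- by apply: ccB; apply: ccZ; apply: ccM.
- apply: ccM => //.
  have -> : (fun z => \sum_(i < 4) f2 i z) =
      (fun z => f2 (inord 0) z + f2 (inord 1) z + f2 (inord 2) z + f2 (inord 3) z).
    by apply/funext => z; rewrite sum_ord4.
  by move=> z; do 3 ?apply: cvgD; exact: cf2.
Qed.

End kern.

Section mean_value.
Variable R : realType.
Implicit Types (x y z : pt4 R) (r : R) (k : nat) (f : pt4 R -> R).

Lemma integrable_box_cst (c d : R) : 0 <= d ->
  (leb4s R).-integrable setT (EFin \o (fun z => c * \1_(box d) z)) /\
  Rintegral (leb4s R) setT (fun z => c * \1_(box d) z) = c * (2 * d) ^+ 4.
Proof.
move=> d0; have mb := @measurable_box R d.
have mi : measurable_fun [set: mpt4 R] (\1_(box d) : pt4 R -> R) by exact: measurable_indic.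
have i1 : (leb4s R).-integrable setT (EFin \o (\1_(box d) : pt4 R -> R)).
  apply: (@integrable_bounded_box _ _ d 1 mi) => x.
    by rewrite indicE; case: (x \in _); rewrite ?normr1 ?normr0.
  by move=> dx; rewrite indicE memNset// => /boxP; rewrite leNgt dx.
split.
  apply: (@integrable_bounded_box _ _ d `|c|) => [|x|x dx].
  - by apply: measurable_funM => //; exact: measurable_cst.
  - rewrite normrM indicE; case: (x \in _); rewrite ?normr1 ?normr0 ?mulr1 ?mulr0//.
  - by rewrite indicE memNset ?mulr0// => /boxP; rewrite leNgt dx.
rewrite RintegralZl//; congr (_ * _).
have E : (\int[leb4s R]_x (\1_(box d) x)%:E = leb4s R (box d `&` setT))%E.
  exact: integral_indic.
by rewrite /Rintegral E setIT -[leb4s R _]/(leb4 (box d)) leb4_box.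
Qed.

Lemma J_ge_box f (c d : R) : 0 <= d -> cc f -> (forall z, 0 <= f z) ->
  (forall z, `|z| <= d -> c <= f z) -> c * (2 * d) ^+ 4 <= J f.
Proof.
move=> d0 ccf f0 cf; have [ib <-] := integrable_box_cst c d0.
apply: le_Rintegral => //; first exact: cc_leb4.
move=> z _; rewrite indicE; have [/set_mem/boxP/cf|_] := boolP (z \in _); first by rewrite mulr1.
by rewrite mulr0.
Qed.

Lemma J_le_box f (c d : R) : 0 <= d -> cc f ->
  (forall z, `|z| <= d -> f z <= c) -> (forall z, d < `|z| -> f z = 0) -> J f <= c * (2 * d) ^+ 4.
Proof.
move=> d0 ccf fc f0; have [ib <-] := integrable_box_cst c d0.
apply: le_Rintegral => //; first exact: cc_leb4.
move=> z _; rewrite indicE; have [/set_mem/boxP/fc|] := boolP (z \in _); first by rewrite mulr1.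
move/negP => zb; rewrite mulr0 f0// ltNge; apply/negP => zd; apply: zb.
exact/mem_set/boxP.
Qed.

(** Makes the normalizing masses independent of the centre, so that they factor out of differences
    taken in the centre. *)
Lemma J_kern_center k r x : J (kern k.+1 r x) = J (kern k.+1 r 0).
Proof.
have mb : measurable_fun [set: mpt4 R] (fun z => (kern k.+1 r x z)%:E).
  by apply/measurable_EFinP; apply: continuous_measurable_pt4; exact: continuous_kern.
have := ge0_integral_shift x mb; rewrite /J /Rintegral => <-.
  by congr fine; apply: eq_integral => z _; rewrite /kern addrK subr0.
by move=> z; rewrite lee_fin kern_ge0.
Qed.

(** On the box of sup radius [d] the squared Euclidean norm is at most 4 d^2; only the contribution
    of this box is kept. *)
Lemma J_kern_lower k r d x : 0 <= d -> 4 * d ^+ 2 <= r ^+ 2 ->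
  (r ^+ 2 - 4 * d ^+ 2) ^+ k.+1 * (2 * d) ^+ 4 <= J (kern k.+1 r x).
Proof.
move=> d0 dr; rewrite J_kern_center; apply: J_ge_box => //.
- exact: cc_kern.
- exact: kern_ge0.
- move=> z zd; rewrite /kern subr0 lerXn2r ?nnegrE ?subr_ge0//; first exact: pp_ge0.
  have h : sq4 z <= 4 * d ^+ 2.
    apply: le_trans (sq4_le z) _; rewrite ler_wpM2l// ler_sqr ?nnegrE//.
  by rewrite pp_pos; lra.
Qed.

Lemma J_kern_upper k r x : 0 <= r -> J (kern k.+1 r x) <= (r ^+ 2) ^+ k.+1 * (2 * r) ^+ 4.
Proof.
move=> r0; rewrite J_kern_center; apply: J_le_box => //.
- exact: cc_kern.
- move=> z _; rewrite /kern subr0 lerXn2r ?nnegrE ?pp_ge0 ?sqr_ge0//.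
  by rewrite /pp ge_max sqr_ge0 andbT lerBlDr lerDl sq4_ge0.
- by move=> z rz; apply: kern_far => //; rewrite subr0 ltW.
Qed.

Lemma J_kern_gt0 k r x : 0 < r -> 0 < J (kern k.+1 r x).
Proof.
move=> r0; apply: lt_le_trans (@J_kern_lower k r (r / 4) x _ _); [|lra|nra].
by apply: mulr_gt0; apply: exprn_gt0; nra.
Qed.

Lemma kern_concentration k r d x z : 0 <= d -> d ^+ 2 <= sq4 (z - x) ->
  d <= r -> kern k.+1 r x z <= (r ^+ 2 - d ^+ 2) ^+ k * kern 1 r x z.
Proof.
move=> d0 dz dr; rewrite /kern expr1 exprSr ler_wpM2r ?pp_ge0// lerXn2r ?nnegrE ?pp_ge0//.
  by rewrite subr_ge0 ler_sqr ?nnegrE// (le_trans d0).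
by rewrite /pp ge_max; apply/andP; split; nra.
Qed.

(* The weights [kern k] concentrate at [x] as k -> oo with [r] fixed: outside the ball of
   radius d they are at most (r^2 - d^2)^k, while on the ball of radius d / 2 they are at
   least (r^2 - d^2 / 4)^k. *)
Lemma kern_approx f r x (n c : R) : 0 < r -> continuous f ->
  (forall k, J (fun z => f z * kern k.+1 r x z) = J (kern k.+1 r x) * (n + c / k.+4%:R)) ->
  n = f x.
Proof.
move=> r0 cf HI; apply/eqP; rewrite -subr_eq0 -normr_eq0.
suff h e : 0 < e -> `|n - f x| <= e * 3.
  rewrite eq_le normr_ge0 andbT; apply/ler_addgt0Pr => e e0; rewrite add0r.
  by have := h (e / 3) ltac:(lra); lra.
move=> e0.
have [d d0 [dr hd]] : exists2 d, 0 < d & d <= r /\ forall z, sq4 (z - x) < d ^+ 2 ->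
  `|f z - f x| <= e.
  have /cvgrPdist_le/(_ _ e0)/nbhs_ballP[d /= d0 hd] := cf x.
  exists (Num.min d r); first by rewrite lt_min d0.
  split; first by rewrite ge_min lexx orbT.
  move=> z zd; rewrite distrC; apply: hd; rewrite -ball_normE /ball_ /= distrC.
  have m0 : 0 <= Num.min d r by rewrite le_min !ltW.
  have : `|z - x| < Num.min d r.
    by rewrite -ltr_sqr ?nnegrE//; apply: le_lt_trans zd; exact: sqr_norm_pt4.
  by rewrite lt_min => /andP[].
have [C C0 hC] : exists2 C, 0 <= C & forall z, `|z| <= `|x| + r -> `|f z - f x| <= C.
  have cg : continuous (fun z => f z - f x) by move=> z; apply: cvgB; [exact: cf|exact: cvg_cst].
  exact: (continuous_box_bounded _ cg).
(* [q'] bounds the base of the kernel from below on the box of sup radius d/4, which lies in the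
   Euclidean ball of radius d/2; [v] is the volume of that box. *)
set q := r ^+ 2 - d ^+ 2; set q' := r ^+ 2 - 4 * (d / 4) ^+ 2.
have q0 : 0 <= q by rewrite /q; nra.
have qq' : q < q' by rewrite /q /q'; nra.
have q'0 : 0 < q' by lra.
pose v := (2 * (d / 4)) ^+ 4; have v0 : 0 < v by apply: exprn_gt0; lra.
pose I1 := J (kern 1 r x); have I10 : 0 < I1 by exact: J_kern_gt0.
(* The term [e] comes from points near [x]. Far points contribute at most C q^k I1, divided by a
   mass of at least q'^(k+1) v; the quotient decays geometrically. *)
have main k : `|n + c / k.+4%:R - f x| <= e + C * I1 / (q' * v) * (q / q') ^+ k.
  have ccb j : cc (kern j.+1 r x) by exact: cc_kern.
  have I0 : 0 < J (kern k.+1 r x) by exact: J_kern_gt0.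
  have cg : continuous (fun z => f z - f x) by move=> z; apply: cvgB; [exact: cf|exact: cvg_cst].
  have E : J (fun z => (f z - f x) * kern k.+1 r x z) = J (kern k.+1 r x) * (n + c / k.+4%:R - f x).
    under [X in J X]eq_fun do rewrite mulrBl.
    by rewrite (JB (ccM cf (ccb k)) (ccZ (f x) (ccb k))) HI (JZ _ (ccb k)); ring.
  have B : `|J (fun z => (f z - f x) * kern k.+1 r x z)| <= e * J (kern k.+1 r x) + C * q ^+ k * I1.
    apply: le_trans (normr_J _) _; first exact: ccM.
    rewrite /I1 -!JZ// -JD; [|exact: ccZ|exact: ccZ].
    apply: le_J => [||z]; [by apply: cc_norm; exact: ccM|by apply: ccD; exact: ccZ|].
    rewrite normrM (ger0_norm (kern_ge0 _ _ _ _)).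
    have b0 := kern_ge0 k.+1 r x z; have b1 := kern_ge0 1 r x z.
    have qk : 0 <= q ^+ k by exact: exprn_ge0.
    have T0 : 0 <= C * q ^+ k * kern 1 r x z by rewrite mulr_ge0// mulr_ge0.
    have T1 : 0 <= e * kern k.+1 r x z by rewrite mulr_ge0// ltW.
    have [zd|zd] := ltP (sq4 (z - x)) (d ^+ 2).
      by apply: (@le_trans _ _ (e * kern k.+1 r x z)); rewrite ?lerDl// ler_wpM2r// hd.
    have [zr|zr] := leP r `|z - x|.
      by rewrite (kern_far k (ltW r0) zr) !mulr0 add0r.
    have zx : `|z| <= `|x| + r by have := lerB_dist z x; lra.
    rewrite -[leLHS]add0r lerD//.
    rewrite -mulrA; apply: ler_pM => //; first exact: hC.
    by apply: kern_concentration => //; exact: ltW.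
  rewrite E normrM (gtr0_norm I0) in B.
  have L : q' ^+ k * (q' * v) <= J (kern k.+1 r x).
    by rewrite mulrA -exprSr; apply: J_kern_lower; [lra|nra].
  have qv : 0 < q' * v by exact: mulr_gt0.
  have q'k : 0 < q' ^+ k by exact: exprn_gt0.
  rewrite -(ler_pM2l I0); apply: le_trans B _; rewrite mulrDr [_ * e]mulrC lerD2l.
  have -> : J (kern k.+1 r x) * (C * I1 / (q' * v) * (q / q') ^+ k) =
      C * q ^+ k * I1 * (J (kern k.+1 r x) / (q' ^+ k * (q' * v))).
    by rewrite expr_div_n; field; rewrite !gt_eqF.
  rewrite ler_peMr//; last by rewrite ler_pdivlMr ?mul1r// mulr_gt0.
  by rewrite mulr_ge0 ?(ltW I10)// mulr_ge0 ?exprn_ge0.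
have [k [k1 k2]] : exists k, `|c / k.+4%:R| <= e /\ C * I1 / (q' * v) * (q / q') ^+ k <= e.
  have t1 : (fun k => C * I1 / (q' * v) * (q / q') ^+ k) @ \oo --> C * I1 / (q' * v) * 0.
    apply: cvgM; first exact: cvg_cst.
    apply: cvg_expr; rewrite ger0_norm ?divr_ge0 ?(ltW q'0)//.
    by rewrite ltr_pdivrMr// mul1r.
  rewrite mulr0 in t1.
  have t2 : (fun k => c * k.+1%:R^-1) @ \oo --> c * 0.
    by apply: cvgM; [exact: cvg_cst|exact: cvg_harmonic].
  rewrite mulr0 in t2.
  have /cvgrPdist_le/(_ _ e0)[N1 _ h1] := t1.
  have /cvgrPdist_le/(_ _ e0)[N2 _ h2] := t2.
  exists (maxn N1 N2); split.
    have /= := h2 (maxn N1 N2).+3; rewrite sub0r normrN; apply.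
    by do 3 apply: leqW; exact: leq_maxr.
  have /= := h1 (maxn N1 N2) (leq_maxl _ _); rewrite sub0r normrN.
  by apply: le_trans; exact: ler_norm.
have := main k; move: k1 k2; move: (c / _) (C * I1 / _ * _) => Y X;
  rewrite !ler_norml => /andP[? ?] ? /andP[? ?].
apply/andP; split; lra.
Qed.

Lemma J0 : J (fun=> 0) = 0 :> R.
Proof. by rewrite /J /Rintegral integral0. Qed.

(** The kernel recursion for the constant function 1. It relates consecutive masses without
    evaluating any of them. *)
Lemma J_kern_recursion k r x : k.+4%:R * J (kern k.+2 r x) = k.+2%:R * r ^+ 2 * J (kern k.+1 r x).
Proof.
have cc0 (a : R) : continuous (fun _ : pt4 R => a) by move=> z; exact: cvg_cst.
have := @kern_recursion R k r x (fun=> 1) (fun=> (fun=> 0)) (fun=> (fun=> 0))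
  (fun i => @partial_cst R i 1) (fun i => @partial_cst R i 0) (cc0 1) (fun=> cc0 0) (fun=> cc0 0).
have E1 j : (fun z => 1 * kern j r x z) = kern j r x by apply/funext => z; rewrite mul1r.
have E0 : (fun z => (\sum_(i < 4) (0 : R)) * kern k.+3 r x z) = fun=> 0.
  by apply/funext => z; rewrite big1// mul0r.
rewrite !E1 E0 J0 => /esym/eqP.
by rewrite !mulf_eq0 !pnatr_eq0 /= subr_eq0 => /eqP.
Qed.

(** With zero Laplacian the weighted integrals of [f] obey the same recursion as the masses, so the
    weighted mean [n] does not depend on [k]; concentration then identifies it with [f x]. *)
Lemma harmonic_mean_value k r x f (f1 f2 : 'I_4 -> pt4 R -> R) : 0 < r ->
  (forall i, partial i f (f1 i)) -> (forall i, partial i (f1 i) (f2 i)) ->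
  continuous f -> (forall i, continuous (f1 i)) -> (forall i, continuous (f2 i)) ->
  (forall z, \sum_(i < 4) f2 i z = 0) ->
  J (fun z => f z * kern k.+1 r x z) = J (kern k.+1 r x) * f x.
Proof.
move=> r0 d1 d2 cf cf1 cf2 f20.
pose n := J (fun z => f z * kern 1 r x z) / J (kern 1 r x).
have H j : J (fun z => f z * kern j.+1 r x z) = J (kern j.+1 r x) * n.
  elim: j => [|j IH]; first by rewrite /n mulrC divfK// gt_eqF// J_kern_gt0.
  have := @kern_recursion R j r x _ _ _ d1 d2 cf cf1 cf2.
  have -> : (fun z => (\sum_(i < 4) f2 i z) * kern j.+3 r x z) = fun=> 0.
    by apply/funext => z; rewrite f20 mul0r.
  rewrite J0 => /esym/eqP; rewrite !mulf_eq0 !pnatr_eq0 /= subr_eq0 IH => /eqP.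
  rewrite mulrA -J_kern_recursion -mulrA => H.
  have c : j.+4%:R != 0 :> R by rewrite pnatr_eq0.
  by rewrite (mulfI c H).
rewrite H; congr (_ * _); apply: (@kern_approx f r x n 0 r0 cf) => j.
by rewrite H mul0r addr0.
Qed.

(** The Laplacian [l] is harmonic, so the source term of the recursion is known exactly. The
    correction c/(k+4) solves the resulting recurrence because 1/(k+4) - 1/((k+4)(k+5)) = 1/(k+5).
    The number [n] is chosen to make the formula hold at [k = 0], and concentration shows that
    [n = f x]. *)
Lemma biharmonic_mean_value k r x f (f1 f2 : 'I_4 -> pt4 R -> R)
    (l1 l2 : 'I_4 -> pt4 R -> R) : 0 < r ->
  let l z := \sum_(i < 4) f2 i z in
  (forall i, partial i f (f1 i)) -> (forall i, partial i (f1 i) (f2 i)) ->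
  (forall i, partial i l (l1 i)) -> (forall i, partial i (l1 i) (l2 i)) ->
  continuous f -> (forall i, continuous (f1 i)) -> (forall i, continuous (f2 i)) ->
  continuous l -> (forall i, continuous (l1 i)) -> (forall i, continuous (l2 i)) ->
  (forall z, \sum_(i < 4) l2 i z = 0) ->
  J (fun z => f z * kern k.+1 r x z) =
  J (kern k.+1 r x) * (f x + (l x * r ^+ 2 / 4) / k.+4%:R).
Proof.
move=> r0 l d1 d2 dl1 dl2 cf cf1 cf2 cl cl1 cl2 l20.
pose c := l x * r ^+ 2 / 4.
pose n := J (fun z => f z * kern 1 r x z) / J (kern 1 r x) - c / 4.
have H j : J (fun z => f z * kern j.+1 r x z) = J (kern j.+1 r x) * (n + c / j.+4%:R).
  elim: j => [|j IH].
    by rewrite /n subrK mulrC divfK// gt_eqF// J_kern_gt0.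
  have := @kern_recursion R j r x _ _ _ d1 d2 cf cf1 cf2.
  rewrite (@harmonic_mean_value j.+2 r x l l1 l2)// IH.
  have R1 := J_kern_recursion j r x; have R2 := J_kern_recursion j.+1 r x.
  rewrite -/l => E; move: R1 R2 E; rewrite /c.
  move: (J _) (J (kern j.+2 r x)) (J (kern j.+1 r x)) (J (kern j.+3 r x)) => H2 I2 I1 I3.
  move=> R1 R2 E.
  have a4 : j.+4%:R = j%:R + 4 :> R by rewrite -natrD addn4.
  have a2 : j.+2%:R = j%:R + 2 :> R by rewrite -natrD addn2.
  have a3 : j.+3%:R = j%:R + 3 :> R by rewrite -natrD addn3.
  have a5 : j.+1.+4%:R = j%:R + 5 :> R by rewrite -natrD -addn4 addSnnS.
  have := ler0n R j; move: R1 R2 E; rewrite a2 a3 a4 a5.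
  move: (j%:R) => a R1 R2 E a0.
  have E' : 4 * (a + 3) * (a + 5) * ((a + 2) * r ^+ 2 * (I1 * (n + l x * r ^+ 2 / 4 / (a + 4)))
    - (a + 4) * H2) = (a + 3) * (r ^+ 2 * I2 * l x).
    transitivity (I3 * l x * (a + 5)); first by rewrite E; ring.
    by transitivity ((a + 5) * I3 * l x); [ring|rewrite R2; ring].
  have E3 : 4 * (a + 5) * ((a + 2) * r ^+ 2 * I1 * (n + l x * r ^+ 2 / 4 / (a + 4)) - (a + 4)
    * H2) = r ^+ 2 * I2 * l x.
    apply: (@mulfI _ (a + 3)); first by rewrite gt_eqF//; lra.
    by rewrite -E'; ring.
  rewrite -R1 in E3.
  have E4 : 4 * (a + 5) * (a + 4) * H2 = 4 * (a + 5) * (a + 4)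
    * (I2 * (n + l x * r ^+ 2 / 4 / (a + 5))).
    transitivity (4 * (a + 5) * ((a + 4) * I2 * (n + l x * r ^+ 2 / 4 / (a + 4)))
      - r ^+ 2 * I2 * l x).
      by rewrite -E3; ring.
    by field; apply/andP; split; rewrite gt_eqF//; lra.
  apply: (mulfI _ E4); rewrite !mulf_eq0 !negb_or !gt_eqF//; lra.
have -> : f x = n by apply/esym; exact: (kern_approx r0 cf H).
exact: H.
Qed.

End mean_value.

(** * Third differences *)

Section differences.
Variable R : realType.
Implicit Types (x y z : pt4 R) (r t a b c : R) (i j l : 'I_4) (f h : pt4 R -> R).

(** Differences instead of derivatives: they pass through [J] by linearity, which avoids
    differentiating under the integral sign. *)
Definition dlt i t f x := f (x + t *: e4 R i) - f x.

Lemma partial_dlt i j t f f' : partial i f f' -> partial i (dlt j t f) (dlt j t f').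
Proof. by move=> df; apply: partialB => //; exact: partial_shift. Qed.

Lemma dlt_bound i t f f' C x : partial i f f' -> (forall y, `|f' y| <= C) ->
  `|dlt i t f x| <= C * `|t|.
Proof.
move=> df fC; rewrite /dlt.
by have [s [_ ->]] := partial_MVT x t df; rewrite normrM ler_wpM2r.
Qed.

(** Differences commute with partial derivatives, so the mean value theorem trades them for
    derivatives one at a time, from the outside inwards. *)
Lemma dlt3_bound i j l a b c f f1 f2 f3 C x :
  partial i f f1 -> partial j f1 f2 -> partial l f2 f3 -> (forall y, `|f3 y| <= C) ->
  `|dlt i a (dlt j b (dlt l c f)) x| <= C * `|c| * `|b| * `|a|.
Proof.
move=> d1 d2 d3 fC; apply: dlt_bound => [|y]; first by do 2 apply: partial_dlt; exact: d1.
apply: dlt_bound => [|y']; first by apply: partial_dlt; exact: d2.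
exact: (dlt_bound _ _ d3).
Qed.

(** Turns variation of the centre into variation of the argument, where the derivative formulas
    apply. *)
Lemma kern_sym k r x z : kern k r x z = kern k r z x.
Proof.
rewrite /kern; have -> // : sq4 (z - x) = sq4 (x - z).
by apply: eq_bigr => i _; rewrite !coord4B -sqrrN opprB.
Qed.

Lemma kern_coord k r x z i : 0 <= r ->
  `|coord4 (z - x) i| * kern k.+1 r x z <= r * kern k.+1 r x z.
Proof.
move=> r0; have [zr|zr] := leP (r ^+ 2) (sq4 (z - x)); first by rewrite kern0// !mulr0.
rewrite ler_wpM2r ?kern_ge0// -ler_sqr ?nnegrE// real_normK ?num_real//.
exact: le_trans (sqr_coord4_le _ _) (ltW zr).
Qed.

Lemma kern_le k r x z : kern k r x z <= (r ^+ 2) ^+ k.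
Proof.
rewrite lerXn2r ?nnegrE ?pp_ge0 ?sqr_ge0//.
by rewrite /pp ge_max sqr_ge0 andbT lerBlDr lerDl sq4_ge0.
Qed.

(** Each derivative lowers the exponent by one or differentiates a coordinate factor. Starting from
    [k.+4], the exponent stays positive, so every coordinate factor is bounded by [r] wherever the
    kernel is nonzero. *)
Lemma kern_third k r z i j l : 0 <= r -> exists f1 f2 f3,
  [/\ partial i (kern k.+4 r z) f1, partial j f1 f2, partial l f2 f3 &
   forall x, `|f3 x| <= 8 * k.+4%:R ^+ 3 * (r ^+ 3 * (r ^+ 2) ^+ k.+1)].
Proof.
move=> r0.
pose y i x := coord4 (x - z) i.
pose d i j : R := (i == j)%:R.
exists (fun x => - (2 * k.+4%:R) * (y i x * kern k.+3 r z x)).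
exists (fun x => - (2 * k.+4%:R) * (d i j * kern k.+3 r z x
   - (2 * k.+3%:R) * (y i x * (y j x * kern k.+2 r z x)))).
exists (fun x => - (2 * k.+4%:R) * (- (2 * k.+3%:R) * d i j * (y l x * kern k.+2 r z x)
   - (2 * k.+3%:R) * (d i l * (y j x * kern k.+2 r z x) + d j l * (y i x * kern k.+2 r z x)
       - (2 * k.+2%:R) * (y i x * (y j x * (y l x * kern k.+1 r z x)))))).
split.
- by apply: eq_partial (@partial_kern R i k.+2 r z) => x.
- apply: eq_partial (partialM (@partial_cst R j (- (2 * k.+4%:R)))
    (partialM (partial_coord4_shift j i z) (@partial_kern R j k.+1 r z))) => x //.
  by rewrite /y /d; cbv beta; ring.
- apply: eq_partial (partialM (@partial_cst R l (- (2 * k.+4%:R)))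
    (partialB (partialM (@partial_cst R l (d i j)) (@partial_kern R l k.+1 r z))
      (partialM (@partial_cst R l (2 * k.+3%:R)) (partialM (partial_coord4_shift l i z)
        (partialM (partial_coord4_shift l j z) (@partial_kern R l k r z)))))) => x //.
  by rewrite /y /d; cbv beta; ring.
- move=> x.
  have yk i' n : `|y i' x| * kern n.+1 r z x <= r * kern n.+1 r z x by exact: kern_coord.
  have k0 n : 0 <= kern n r z x by exact: kern_ge0.
  have K2 i' : `|y i' x * kern k.+2 r z x| <= r ^+ 3 * (r ^+ 2) ^+ k.+1.
    rewrite normrM (ger0_norm (k0 _)); apply: le_trans (yk _ _) _.
    rewrite [r ^+ 3]exprS -mulrA -exprS ler_wpM2l//; exact: kern_le.
  have K1 : `|y i x * (y j x * (y l x * kern k.+1 r z x))| <= r ^+ 3 * (r ^+ 2) ^+ k.+1.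
    rewrite !normrM (ger0_norm (k0 _)).
    apply: (@le_trans _ _ (r ^+ 3 * kern k.+1 r z x));
      last by rewrite ler_wpM2l ?exprn_ge0// kern_le.
    have h3 := yk l k; have h2 := yk j k; have h1 := yk i k.
    have -> : r ^+ 3 * kern k.+1 r z x = r * (r * (r * kern k.+1 r z x)) by rewrite !exprS expr0;
      ring.
    apply: (@le_trans _ _ (`|y i x| * (`|y j x| * (r * kern k.+1 r z x)))).
      by rewrite !ler_wpM2l.
    rewrite [`|y j x| * _]mulrCA [`|y i x| * (r * _)]mulrCA ler_wpM2l//.
    apply: (@le_trans _ _ (`|y i x| * (r * kern k.+1 r z x))); first by rewrite ler_wpM2l.
    by rewrite mulrCA ler_wpM2l.
  have dle i' j' : 0 <= d i' j' <= 1 by rewrite /d; case: (_ == _) => /=; lra.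
  have Kl := K2 l; have Kj := K2 j; have Ki := K2 i.
  move: (r ^+ 3 * (r ^+ 2) ^+ k.+1) K1 Kl Kj Ki => B K1 Kl Kj Ki.
  move: (y l x * _) (y j x * kern k.+2 r z x) (y i x * kern k.+2 r z x) (y i x * (_ * _))
    K1 Kl Kj Ki.
  move=> p1 p2 p3 p4 K1 Kl Kj Ki.
  have B0 : 0 <= B by exact: le_trans (normr_ge0 _) K1.
  have a4 : k.+4%:R = k%:R + 4 :> R by rewrite -natrD addn4.
  have a2 : k.+2%:R = k%:R + 2 :> R by rewrite -natrD addn2.
  have a3 : k.+3%:R = k%:R + 3 :> R by rewrite -natrD addn3.
  have := ler0n R k; rewrite a2 a3 a4; move: (k%:R) => n n0.
  have S i' j' p : `|p| <= B -> `|d i' j' * p| <= B.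
    move=> pB; have /andP[d0 d1] := dle i' j'; rewrite normrM (ger0_norm d0).
    by apply: le_trans pB; rewrite ler_piMl.
  have S1 := S i j _ Kl; have S2 := S i l _ Kj; have S3 := S j l _ Ki.
  rewrite -[- _ * d i j * p1]mulrA.
  move: (d i j * p1) (d i l * p2) (d j l * p3) S1 S2 S3 => q1 q2 q3 S1 S2 S3.
  have N0 : `|2 * (n + 2) * p4| <= 2 * (n + 2) * B.
    by rewrite normrM ger0_norm ?ler_wpM2l//; lra.
  have N1 : `|q2 + q3 - 2 * (n + 2) * p4| <= (2 * n + 6) * B.
    move: N0 S2 S3; rewrite !ler_norml => /andP[? ?] /andP[? ?] /andP[? ?]; apply/andP; split; lra.
  have N2 : `|- (2 * (n + 3)) * q1 - 2 * (n + 3) * (q2 + q3 - 2 * (n + 2) * p4)| <= 2 * (n + 3)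
    * (2 * n + 7) * B.
    have -> : - (2 * (n + 3)) * q1 - 2 * (n + 3) * (q2 + q3 - 2 * (n + 2) * p4) =
      - (2 * (n + 3)) * (q1 + (q2 + q3 - 2 * (n + 2) * p4)) by ring.
    have c0 : 0 <= 2 * (n + 3) by lra.
    rewrite normrM normrN (ger0_norm c0) -[leRHS]mulrA ler_wpM2l//.
    move: N1 S1; rewrite !ler_norml => /andP[? ?] /andP[? ?]; apply/andP; split; lra.
  have c4 : 0 <= 2 * (n + 4) by lra.
  rewrite normrM normrN (ger0_norm c4).
  apply: le_trans (ler_wpM2l c4 N2) _.
  (* What remains is 4 (n+4) (n+3) (2n+7) <= 8 (n+4)^3. *)
  rewrite !mulrA; apply: ler_wpM2r => //.
  nra.
Qed.

End differences.

Section third_differences.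
Variable R : realType.
Implicit Types (x y z : pt4 R) (r t a b c : R) (i j l : 'I_4) (f h : pt4 R -> R).

Lemma Ck4D k f g : Ck4 k f -> Ck4 k g -> Ck4 k (fun x => f x + g x).
Proof.
elim: k f g => [|k IH] f g /=; first by move=> cf cg x; apply: cvgD; [exact: cf|exact: cg].
move=> [df cf] [dg cg]; have dfg i := partialD (partial_dpart4 (df i)) (partial_dpart4 (dg i)).
split=> [i x|i]; last by rewrite (partialE (dfg i)); exact: IH.
by have := dfg i x; under [X in _ -> derivable X _ _]eq_fun do rewrite !addcoord4E; case.
Qed.

Lemma Ck4_lap k f : Ck4 k.+2 f -> Ck4 k (lap4 f).
Proof.
move=> [_ cf].
have -> : lap4 f = fun x =>
  dpart4 (inord 0) (dpart4 (inord 0) f) x + dpart4 (inord 1) (dpart4 (inord 1) f) x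
  + dpart4 (inord 2) (dpart4 (inord 2) f) x + dpart4 (inord 3) (dpart4 (inord 3) f) x.
  by apply/funext => x; rewrite /lap4 sum_ord4.
have c i : Ck4 k (dpart4 i (dpart4 i f)) by case: (cf i) => _; apply.
by do 3 apply: Ck4D => //.
Qed.

Lemma Ck4_partial k f i : Ck4 k.+1 f -> partial i f (dpart4 i f).
Proof. by case=> df _; exact: partial_dpart4. Qed.

Lemma Ck4_dpart k f i : Ck4 k.+1 f -> Ck4 k (dpart4 i f).
Proof. by case=> _; apply. Qed.

Lemma Ck4_mean_value k r x h : 0 < r -> Ck4 4 h -> (forall x, bilap4 h x = 0) ->
  J (fun z => h z * kern k.+1 r x z) =
  J (kern k.+1 r x) * (h x + (lap4 h x * r ^+ 2 / 4) / k.+4%:R).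
Proof.
move=> r0 ch b0; have cl := Ck4_lap ch.
have d1 i := Ck4_partial i ch.
have d2 i := Ck4_partial i (Ck4_dpart i ch).
have d3 i := Ck4_partial i cl.
have d4 i := Ck4_partial i (Ck4_dpart i cl).
have c1 i := Ck4_continuous (Ck4_dpart i ch).
have c2 i := Ck4_continuous (Ck4_dpart i (Ck4_dpart i ch)).
have c3 i := Ck4_continuous (Ck4_dpart i cl).
have c4 i := Ck4_continuous (Ck4_dpart i (Ck4_dpart i cl)).
exact: (@biharmonic_mean_value R k r x h _ _ _ _ r0 d1 d2 d3 d4
  (Ck4_continuous ch) c1 c2 (Ck4_continuous cl) c3 c4 b0).
Qed.

Lemma dlt_J h i t (F : pt4 R -> pt4 R -> R) : (forall x, cc (fun z => h z * F x z)) ->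
  (forall x, cc (fun z => h z * dlt i t (F ^~ z) x)) /\
  dlt i t (fun x => J (fun z => h z * F x z)) = fun x => J (fun z => h z * dlt i t (F ^~ z) x).
Proof.
move=> ccF.
have E x : (fun z => h z * dlt i t (F ^~ z) x) = fun z => h z * F (x + t *: e4 R i) z - h z * F x z.
  by apply/funext => z; rewrite /dlt mulrBr.
split=> [x|]; first by rewrite E; exact: ccB.
by apply/funext => x; rewrite E JB.
Qed.

Lemma dlt_comb i t f g (p q : R) :
  dlt i t (fun x => p * f x - q * g x) = fun x => p * dlt i t f x - q * dlt i t g x.
Proof. by apply/funext => x; rewrite /dlt; ring. Qed.

Lemma dlt3_J h i j l a b c k r x : continuous h ->
  cc (fun z => h z * dlt i a (dlt j b (dlt l c (fun x' => kern k.+1 r x' z))) x) /\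
  dlt i a (dlt j b (dlt l c (fun x' => J (fun z => h z * kern k.+1 r x' z)))) x =
  J (fun z => h z * dlt i a (dlt j b (dlt l c (fun x' => kern k.+1 r x' z))) x).
Proof.
move=> ch.
have [c1 E1] := @dlt_J h l c (kern k.+1 r) (fun x' => ccM ch (cc_kern k r x')).
have [c2 E2] := @dlt_J h j b (fun x' z => dlt l c (fun x' => kern k.+1 r x' z) x') c1.
have [c3 E3] := @dlt_J h i a (fun x' z => dlt j b (dlt l c (fun x' => kern k.+1 r x' z)) x') c2.
by split; [exact: c3|rewrite E1 E2 E3].
Qed.

Lemma norm_addZe x i t : `|x + t *: e4 R i| <= `|x| + `|t|.
Proof. by apply: le_trans (ler_normD _ _) _; rewrite normrZ normeE mulr1. Qed.

(** The centres occurring in the difference all lie in the box of radius [r], so everything vanishes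
    when [|z|] is at least [2 * r]. The majorant is centered at 0, independently of [x], so that the
    growth bound can be applied to it. *)
Lemma kern_dlt3 k r z x i j l a b c : 0 < r -> `|x| + `|a| + `|b| + `|c| <= r ->
  `|dlt i a (dlt j b (dlt l c (fun x' => kern k.+4 r x' z))) x| <=
  8 * k.+4%:R ^+ 3 * (r * (r ^+ 2) ^+ k.+1) * (`|c| * `|b| * `|a|) * kern 1 (8 * r) 0 z.
Proof.
move=> r0 xr.
have -> : (fun x' => kern k.+4 r x' z) = kern k.+4 r z by apply/funext => x'; rewrite kern_sym.
have rr : 0 <= r ^+ 2 by exact: sqr_ge0.
have pos : 0 <= 8 * k.+4%:R ^+ 3 * (r * (r ^+ 2) ^+ k.+1) * (`|c| * `|b| * `|a|).
  by rewrite !mulr_ge0 ?(exprn_ge0 _ (ler0n _ _)) ?(exprn_ge0 _ rr) ?(ltW r0).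
have [z2|z2] := ltP `|z| (2 * r).
  have [f1 [f2 [f3 [d1 d2 d3 f3b]]]] := kern_third k z i j l (ltW r0).
  apply: le_trans (dlt3_bound a b c x d1 d2 d3 f3b) _.
  (* Here the squared Euclidean norm of [z] is at most 16 r^2, well below (8 r)^2. *)
  have K : r ^+ 2 <= kern 1 (8 * r) 0 z.
    have := sq4_le z; rewrite /kern expr1 subr0 => h.
    have r2 : 0 <= 2 * r by lra.
    have h2 : `|z| ^+ 2 <= (2 * r) ^+ 2 by rewrite ler_sqr ?nnegrE// ltW.
    rewrite pp_pos; nra.
  have -> : 8 * k.+4%:R ^+ 3 * (r ^+ 3 * (r ^+ 2) ^+ k.+1) * `|c| * `|b| * `|a| =
    8 * k.+4%:R ^+ 3 * (r * (r ^+ 2) ^+ k.+1) * (`|c| * `|b| * `|a|) * r ^+ 2.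
    by rewrite [r ^+ 3]exprS; ring.
  exact: ler_wpM2l.
have k0 w : `|w| <= r -> kern k.+4 r z w = 0.
  move=> wr; rewrite kern_sym (kern_far _ (ltW r0))//.
  by have := lerB_dist z w; lra.
rewrite /dlt !k0 ?subrr ?normr0.
  by rewrite mulr_ge0// kern_ge0.
all: have na := normr_ge0 a; have nb := normr_ge0 b; have nc := normr_ge0 c.
all: do ? (apply: le_trans (norm_addZe _ _ _) _); try lra.
all: apply: le_trans (_ : `|x| + `|a| + `|b| + `|c| <= _) => //.
all: have A1 := norm_addZe x i a; have A2 := norm_addZe x j b; have A3 := norm_addZe x l c.
all: have A4 := norm_addZe (x + a *: e4 R i) j b; have A5 := norm_addZe (x + a *: e4 R i) l c.
all: have A6 := norm_addZe (x + b *: e4 R j) l c;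
  have A7 := norm_addZe (x + a *: e4 R i + b *: e4 R j) l c.
all: lra.
Qed.

(** For the kernel of order 5 the factors are r^5 from its third difference, r^8 from the weighted
    integral of |h| and r^-14 from the mass; for order 4 they are r^3, r^8 and r^-12. Both products
    are r^-1. *)
Lemma third_difference0 h C0 r0 : Ck4 4 h -> (forall x, bilap4 h x = 0) ->
  (forall r, r0 <= r -> J (fun z => pp (h z) * kern 1 r 0 z) <= C0 * r ^+ 8) ->
  forall i j l a b c x, dlt i a (dlt j b (dlt l c h)) x = 0.
Proof.
move=> ch b0 growth i j l a b c x.
have cont := Ck4_continuous ch.
set X := dlt _ _ _ _; pose T := `|c| * `|b| * `|a|.
have T0 : 0 <= T by rewrite !mulr_ge0.
(* The first term is twice the growth bound at radius 8 r. In the second, 64 * 16^4 is the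
   coefficient of r^6 in the upper bound (8 r)^2 (16 r)^4 of the mass. *)
pose C1 := 2 * 8 ^+ 8 * `|C0| + 64 * 16 ^+ 4 * (`|h 0| + 4 * `|lap4 h 0|).
have C10 : 0 <= C1 by rewrite addr_ge0// !mulr_ge0 ?exprn_ge0// addr_ge0// mulr_ge0.
have [d5 d50 d5E] : exists2 d, 0 <= d & d = 8 * 5%:R ^+ 3 :> R.
  by exists (8 * 5%:R ^+ 3) => //; rewrite mulr_ge0 ?exprn_ge0.
have [d4 d40 d4E] : exists2 d, 0 <= d & d = 8 * 4%:R ^+ 3 :> R.
  by exists (8 * 4%:R ^+ 3) => //; rewrite mulr_ge0 ?exprn_ge0.
pose C3 := (8 * d5 * 128 + 7 * d4 * 128) * (T * C1).
have C30 : 0 <= C3 by apply: mulr_ge0; [lra|exact: mulr_ge0].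
(* Beyond [r1], the radius is at least 1, the growth bound is available at 8 r, and all points of
   the third difference stay in the box of radius [r]. *)
pose r1 := Num.max 1 r0 + (`|x| + `|a| + `|b| + `|c|).
have main r : r1 <= r -> r * `|X| <= C3.
  move=> r1r.
  have s0 : 0 <= `|x| + `|a| + `|b| + `|c| by rewrite !addr_ge0.
  have m1 : 1 <= Num.max 1 r0 by rewrite le_max lexx.
  have m0 : r0 <= Num.max 1 r0 by rewrite le_max lexx orbT.
  have r_1 : 1 <= r by rewrite /r1 in r1r; lra.
  have r_0 : r0 <= 8 * r by rewrite /r1 in r1r; lra.
  have xr : `|x| + `|a| + `|b| + `|c| <= r by rewrite /r1 in r1r; lra.
  have rp : 0 < r by lra.
  pose W := J (fun z => `|h z| * kern 1 (8 * r) 0 z).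
  have cck : cc (kern 1 (8 * r) 0) by exact: cc_kern.
  have cpp : continuous (fun z => pp (h z)).
    by move=> z; apply: continuous_comp; [exact: cont|exact: continuous_pp].
  have W1 : W <= C1 * r ^+ 8.
    have E : W = 2 * J (fun z => pp (h z) * kern 1 (8 * r) 0 z) - J (fun z =>
      h z * kern 1 (8 * r) 0 z).
      rewrite -JZ; last exact: ccM.
      rewrite -JB; [|by apply: ccZ; exact: ccM|exact: ccM].
      rewrite /W; congr J; apply/funext => z; rewrite mulrA -mulrBl; congr (_ * _).
      by have [hz|hz] := leP 0 (h z);
        [rewrite pp_pos// ger0_norm//|rewrite pp_neg ?ltW// ltr0_norm//]; ring.
    have mv := @Ck4_mean_value 0 (8 * r) 0 h ltac:(lra) ch b0.
    have I0 := @J_kern_gt0 R 0 (8 * r) 0 ltac:(lra).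
    have Iu := @J_kern_upper R 0 (8 * r) 0 ltac:(lra).
    have gr := growth _ r_0.
    set P := h 0 + _ in mv.
    have P1 : `|P| <= (`|h 0| + 4 * `|lap4 h 0|) * r ^+ 2.
      have -> : P = h 0 + 4 * lap4 h 0 * r ^+ 2 by rewrite /P; field.
      apply: le_trans (ler_normD _ _) _; rewrite [leRHS]mulrDl lerD//.
        by rewrite ler_peMr// exprn_ege1.
      by rewrite normrM (ger0_norm (sqr_ge0 r)) normrM normr_nat.
    have P2 : - (J (kern 1 (8 * r) 0) * P) <= 64 * 16 ^+ 4 * (`|h 0| + 4 * `|lap4 h 0|) * r ^+ 8.
      apply: le_trans (ler_norm _) _; rewrite normrN normrM gtr0_norm//.
      have -> : 64 * 16 ^+ 4 * (`|h 0| + 4 * `|lap4 h 0|) * r ^+ 8 =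
        ((8 * r) ^+ 2) ^+ 1 * (2 * (8 * r)) ^+ 4 * ((`|h 0| + 4 * `|lap4 h 0|) * r ^+ 2) by ring.
      by apply: ler_pM => //; exact: ltW.
    have G2 : C0 * (8 * r) ^+ 8 <= `|C0| * (8 ^+ 8 * r ^+ 8).
      by rewrite exprMn ler_wpM2r ?ler_norm// mulr_ge0 ?exprn_ge0// ltW.
    rewrite E mv /C1 [leRHS]mulrDl lerD//.
    by have := le_trans gr G2; lra.
  have bnd k : `|dlt i a (dlt j b (dlt l c (fun x' => J (fun z => h z * kern k.+4 r x' z)))) x| <=
      8 * k.+4%:R ^+ 3 * (r * (r ^+ 2) ^+ k.+1) * T * W.
    have [c3 ->] := dlt3_J i j l a b c k.+3 r x cont.
    have cn : continuous (fun z => `|h z|) by move=> z; apply: cvg_norm; exact: cont.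
    apply: le_trans (normr_J c3) _; rewrite -JZ; last exact: ccM.
    apply: le_J => [||z]; [exact: cc_norm|by apply: ccZ; exact: ccM|].
    rewrite normrM mulrCA ler_wpM2l//; exact: kern_dlt3.
  have B5 := bnd 1%N; have B4 := bnd 0%N.
  pose I5 := J (kern 5 r 0); pose I4 := J (kern 4 r 0).
  have I5p : 0 < I5 by exact: J_kern_gt0.
  have I4p : 0 < I4 by exact: J_kern_gt0.
  (* The Laplacian enters the two normalized means with factors 1/8 and 1/7, so the weights 8 and -7
     cancel it and sum to 1. *)
  have hE : h = fun x => 8 / I5 * J (fun z => h z * kern 5 r x z) - 7 / I4 * J (fun z =>
    h z * kern 4 r x z).
    apply/funext => y; rewrite !Ck4_mean_value// (J_kern_center 4) (J_kern_center 3) -/I5 -/I4.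
    by field; rewrite !gt_eqF.
  have XE : X = 8 / I5 * dlt i a (dlt j b (dlt l c (fun x' => J (fun z => h z * kern 5 r x' z)))) x
    - 7 / I4 * dlt i a (dlt j b (dlt l c (fun x' => J (fun z => h z * kern 4 r x' z)))) x.
    by rewrite /X {1}hE !dlt_comb.
  (* The box of radius r/4 gives the factor (3/4)^5 / 16, which exceeds 1/128; likewise (3/4)^4 / 16
     for [I4]. *)
  have I5l : r ^+ 14 <= 128 * I5.
    have := @J_kern_lower R 4 r (r / 4) 0 ltac:(lra) ltac:(nra); rewrite -/I5.
    have -> : (r ^+ 2 - 4 * (r / 4) ^+ 2) ^+ 5 * (2 * (r / 4)) ^+ 4 = (3 / 4)
      ^+ 5 / 16 * r ^+ 14 by field.
    have : 0 <= r ^+ 14 by apply: exprn_ge0; lra.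
    lra.
  have I4l : r ^+ 12 <= 128 * I4.
    have := @J_kern_lower R 3 r (r / 4) 0 ltac:(lra) ltac:(nra); rewrite -/I4.
    have -> : (r ^+ 2 - 4 * (r / 4) ^+ 2) ^+ 4 * (2 * (r / 4)) ^+ 4 = (3 / 4)
      ^+ 4 / 16 * r ^+ 12 by field.
    have : 0 <= r ^+ 12 by apply: exprn_ge0; lra.
    lra.
  have TW : T * W <= T * (C1 * r ^+ 8) by rewrite ler_wpM2l.
  have Q5 : r * (8 / I5 * `|dlt i a (dlt j b (dlt l c (fun x' => J (fun z =>
    h z * kern 5 r x' z)))) x|)
      <= 8 * d5 * 128 * (T * C1).
    apply: (@le_trans _ _ (r * (8 / I5 * (d5 * r ^+ 5 * (T * (C1 * r ^+ 8)))))).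
      rewrite ler_wpM2l ?(ltW rp)// ler_wpM2l ?divr_ge0 ?(ltW I5p)//.
      apply: le_trans B5 _.
      have -> : 8 * 5%:R ^+ 3 * (r * (r ^+ 2) ^+ 2) * T * W = d5 * r ^+ 5 * (T * W)
        by rewrite d5E; ring.
      by rewrite ler_wpM2l// mulr_ge0// exprn_ge0// ltW.
    have -> : r * (8 / I5 * (d5 * r ^+ 5 * (T * (C1 * r ^+ 8)))) = 8 * d5 * (T * C1)
      * (r ^+ 14 / I5).
      by field; rewrite gt_eqF.
    rewrite [8 * d5 * 128 * _]mulrAC ler_wpM2l ?mulr_ge0//.
    by rewrite ler_pdivrMr.
  have Q4 : r * (7 / I4 * `|dlt i a (dlt j b (dlt l c (fun x' => J (fun z =>
    h z * kern 4 r x' z)))) x|)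
      <= 7 * d4 * 128 * (T * C1).
    apply: (@le_trans _ _ (r * (7 / I4 * (d4 * r ^+ 3 * (T * (C1 * r ^+ 8)))))).
      rewrite ler_wpM2l ?(ltW rp)// ler_wpM2l ?divr_ge0 ?(ltW I4p)//.
      apply: le_trans B4 _.
      have -> : 8 * 4%:R ^+ 3 * (r * (r ^+ 2) ^+ 1) * T * W = d4 * r ^+ 3 * (T * W)
        by rewrite d4E; ring.
      by rewrite ler_wpM2l// mulr_ge0// exprn_ge0// ltW.
    have -> : r * (7 / I4 * (d4 * r ^+ 3 * (T * (C1 * r ^+ 8)))) = 7 * d4 * (T * C1)
      * (r ^+ 12 / I4).
      by field; rewrite gt_eqF.
    rewrite [7 * d4 * 128 * _]mulrAC ler_wpM2l ?mulr_ge0//.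
    by rewrite ler_pdivrMr.
  rewrite XE /C3 [leRHS]mulrDl; apply: le_trans (lerD Q5 Q4); rewrite -mulrDr ler_wpM2l ?(ltW rp)//.
  apply: le_trans (ler_normB _ _) _; rewrite [X in X + _ <= _]normrM [X in _ + X <= _]normrM.
  by rewrite (@ger0_norm _ (8 / I5)) ?(@ger0_norm _ (7 / I4)) ?divr_ge0 ?(ltW I5p) ?(ltW I4p).
apply/eqP/negPn/negP => X0; have Xp : 0 < `|X| by rewrite normr_gt0.
have r1p : 0 < r1 by rewrite ltr_pwDl ?addr_ge0// lt_max ltr01.
(* At this radius the bound would read r1 |X| + C3 <= C3, impossible for nonzero [X]. *)
have := main (r1 + C3 / `|X|); rewrite lerDl divr_ge0// => /(_ isT).
by rewrite mulrDl divfK ?gt_eqF// gerDr leNgt mulr_gt0.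
Qed.

End third_differences.

(** * Vanishing third differences force a quadratic polynomial *)

Section quadratic.
Variable R : realType.
Implicit Types (x y z : pt4 R) (r t a b c : R) (i j l : 'I_4) (f h : pt4 R -> R).

Lemma partial_dlt0 i f f' : partial i f f' -> (forall t x, dlt i t f x = 0) -> forall x, f' x = 0.
Proof.
move=> df f0 x; have := df x.
have -> : (fun t => f (x + t *: e4 R i)) = fun=> f x.
  by apply/funext => t; apply/eqP; rewrite -subr_eq0; apply/eqP; exact: f0.
by move=> /@derive_val <-; rewrite derive_cst.
Qed.

Lemma dlt0_const f : (forall i t x, dlt i t f x = 0) -> forall x, f x = f 0.
Proof.
move=> f0 x; have step i t y : f (y + t *: e4 R i) = f y.
  by apply/eqP; rewrite -subr_eq0; apply/eqP; exact: f0.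
by rewrite [in LHS](decomp_e4 x) !step -(add0r (_ *: _)) step.
Qed.

(** Two of the three differences are converted into derivatives, so second derivatives have zero
    differences and are constant. Then the gradient is affine and [h] quadratic along each axis, and
    a walk from 0 along the four axes gives the formula. *)
Lemma third_difference0_quadratic h : Ck4 2 h ->
  (forall i j l a b c x, dlt i a (dlt j b (dlt l c h)) x = 0) -> poly_deg_le24 h.
Proof.
move=> ch h0.
pose g i := dpart4 i h; have dh i : partial i h (g i) by exact: Ck4_partial ch.
have dg i j : partial j (g i) (dpart4 j (g i)) by exact: (Ck4_partial j (Ck4_dpart i ch)).
have g0 i j l b c x : dlt j b (dlt l c (g i)) x = 0.
  by apply: (@partial_dlt0 i (dlt j b (dlt l c h))) => //; do 2 apply: partial_dlt.
have gg0 i j l c x : dlt l c (dpart4 j (g i)) x = 0.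
  by apply: (@partial_dlt0 j (dlt l c (g i))) => //; apply: partial_dlt.
pose A j i := dpart4 j (g i) 0.
have gA j i x : dpart4 j (g i) x = A j i by exact: dlt0_const.
have gstep j i x t : g i (x + t *: e4 R j) = g i x + A j i * t.
  by have [s [_]] := partial_MVT x t (dg i j); rewrite gA => E; lra.
have hstep i x t : h (x + t *: e4 R i) = h x + g i x * t + A i i / 2 * t ^+ 2.
  (* Subtracting the expected quadratic in [w] leaves a function whose derivative vanishes on the
     line through [x] in direction [i]. *)
  pose w y := coord4 y i - coord4 x i.
  have dw : partial i w (fun=> 1).
    apply: eq_partial (partialB (@partial_coord4 R i i) (@partial_cst R i (coord4 x i))) => y //.
    by rewrite eqxx subr0.
  have dF : partial i (fun y => h y - (A i i / 2 * (w y * w y) + g i x * w y))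
      (fun y => g i y - (A i i * w y + g i x)).
    apply: eq_partial (partialB (dh i) (partialD (partialM (@partial_cst R i (A i i / 2))
      (partialM dw dw))
      (partialM (@partial_cst R i (g i x)) dw))) => y //.
    by cbv beta; field.
  have wt s : w (x + s *: e4 R i) = s by rewrite /w coord4D coord4Z coord4e eqxx /=; ring.
  have [s [_]] := partial_MVT x t dF; rewrite !wt gstep.
  have -> : w x = 0 by rewrite /w subrr.
  by move=> E; lra.
exists (h 0), (fun i => g i 0),
  (* The walk takes the axes in increasing order: the slope along [j] has already changed by [A i j]
     times the coordinate [i] for each earlier [i], hence the triangular form. *)
  (fun i j => if i == j then A i i / 2 else if (i < j)%N then A i j else 0) => x.
rewrite {1}(decomp_e4 x) -(add0r (coord4 x (inord 0) *: _)) !hstep !gstep.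
rewrite !sum_ord4 -!val_eqE /= !inordK//=.
move: (A (inord 0) (inord 0)) (A (inord 0) (inord 1)) (A (inord 0) (inord 2)) (A (inord 0)
  (inord 3)) (A (inord 1) (inord 1)) (A (inord 1) (inord 2)) (A (inord 1) (inord 3)) (A (inord 2)
  (inord 2)) (A (inord 2) (inord 3)) (A (inord 3) (inord 3)).
move: (h 0) (g (inord 0) 0) (g (inord 1) 0) (g (inord 2) 0) (g (inord 3) 0) (coord4 x (inord 0))
  (coord4 x (inord 1)) (coord4 x (inord 2)) (coord4 x (inord 3)).
by move=> *; field.
Qed.

End quadratic.

(** * The logarithmic potential *)

Section log_kernel.
Variable R : realType.
Implicit Types (x y z : pt4 R) (r t : R).

(** The cut-off at 1 encodes the unit ball, so that the local logarithmic integral becomes a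
    convolution over the whole space. *)
Definition log1 t : R := `|ln t| * \1_(`]-oo, 1[%classic) t.

Lemma log1_ge0 t : 0 <= log1 t.
Proof. by rewrite mulr_ge0// indicE. Qed.

Lemma measurable_log1 : measurable_fun setT log1.
Proof.
apply: measurable_funM; last exact: measurable_indic.
by apply: measurableT_comp; [exact: normr_measurable|exact: measurable_ln].
Qed.

Lemma measurable_coord4 i : measurable_fun [set: mpt4 R] (fun x : pt4 R => coord4 x i).
Proof. by apply: continuous_measurable_pt4; exact: continuous_coord4. Qed.

Lemma measurable_edist4 : measurable_fun [set: (mpt4 R * mpt4 R)%type]
  (fun w : pt4 R * pt4 R => edist4 w.1 w.2).
Proof.
have m i : measurable_fun [set: (mpt4 R * mpt4 R)%type]
    (fun w : pt4 R * pt4 R => (coord4 w.1 i - coord4 w.2 i) ^+ 2).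
  apply: measurable_funX; apply: measurable_funB.
    exact: (measurableT_comp (measurable_coord4 i) measurable_fst).
  exact: (measurableT_comp (measurable_coord4 i) measurable_snd).
have ms : measurable_fun setT (@Num.sqrt R).
  by apply: continuous_measurable_fun; exact: sqrt_continuous.
apply: (measurableT_comp ms).
have -> : (fun w : pt4 R * pt4 R => \sum_(i < 4) (coord4 w.1 i - coord4 w.2 i) ^+ 2) =
  (fun w => (coord4 w.1 (inord 0) - coord4 w.2 (inord 0)) ^+ 2 + (coord4 w.1 (inord 1)
    - coord4 w.2 (inord 1)) ^+ 2
  + (coord4 w.1 (inord 2) - coord4 w.2 (inord 2)) ^+ 2 + (coord4 w.1 (inord 3)
    - coord4 w.2 (inord 3)) ^+ 2).
  by apply/funext => w; rewrite sum_ord4.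
by do 3 ?apply: measurable_funD; exact: m.
Qed.

(* [- ln t] is at most the number of n with [t <= expR (- n)]. *)
Lemma log1_le_series z :
  ((log1 (enorm4 z))%:E <= \sum_(0 <= n <oo) (\1_(box (expR (- n%:R))) z)%:E)%E.
Proof.
have ge0 n : (0 <= (\1_(box (expR (- n%:R))) z : R)%:E)%E by rewrite lee_fin indicE.
rewrite /log1 indicE; have [/set_mem/= t1|_] := boolP (enorm4 z \in _); last first.
  by rewrite mulr0; apply: nneseries_ge0.
rewrite mulr1; rewrite in_itv/= in t1.
have [t0|t0] := leP (enorm4 z) 0; first by rewrite ln0// normr0; exact: nneseries_ge0.
have ln0 : ln (enorm4 z) <= 0 by rewrite ln_le0// ltW.
set s := `|ln (enorm4 z)|; have sE : s = - ln (enorm4 z) by rewrite /s ler0_norm.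
(* The indices n = 0, ..., [truncn s] all satisfy n <= s and so contribute 1; their number
   [truncn s + 1] exceeds [s]. *)
apply: le_trans (@nneseries_lim_ge R (fun n =>
  (\1_(box (expR (- n%:R))) z)%:E) predT 0%N (Num.truncn s).+1 _) => //.
rewrite (eq_big_nat _ _ (F2 := fun=> 1%E)) => [|n /andP[_ ns]].
  by rewrite sumEFin lee_fin big_const_nat subn0 iter_addr addr0 ltW// truncnS_gt.
rewrite indicE mem_set//; apply/boxP; apply: le_trans (norm_pt4_enorm4 z) _.
rewrite -(@lnK _ (enorm4 z)) ?posrE// ler_expR lerNr -sE.
apply: le_trans (_ : (Num.truncn s)%:R <= _); first by rewrite ler_nat.
by rewrite truncn_le ?normr_ge0.
Qed.

(** Translation removes [y]. The box of radius e^-n has volume 16 e^(-4n), so integrating the series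
    of indicators leaves a geometric series of ratio [q]. *)
Lemma integral_log1_fin : exists2 L : R, 0 <= L &
  forall y, (\int[leb4s R]_x (log1 (edist4 x y))%:E <= L%:E)%E.
Proof.
pose q : R := expR (-1) ^+ 4.
have q0 : 0 <= q by rewrite exprn_ge0// expR_ge0.
have q1 : q < 1.
  by rewrite exprn_ilt1// ?expR_ge0// -expR0 ltr_expR oppr_lt0.
exists (16 / (1 - q)); first by rewrite divr_ge0// subr_ge0 ltW.
move=> y.
have mE : measurable_fun [set: mpt4 R] (fun x : pt4 R => (log1 (enorm4 x))%:E).
  apply/measurable_EFinP; apply: (measurableT_comp measurable_log1).
  apply: continuous_measurable_pt4 => x.
  by apply: continuous_comp; [exact: continuous_sq4|exact: sqrt_continuous].
have E : (\int[leb4s R]_x (log1 (edist4 x y))%:E = \int[leb4s R]_x (log1 (enorm4 x))%:E)%E.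
  rewrite -(@ge0_integral_shift R (- y) _ mE); last by move=> x; rewrite lee_fin log1_ge0.
  by apply: eq_integral => x _; rewrite edist4E.
rewrite E.
have mb n : measurable_fun [set: mpt4 R] (fun z => (\1_(box (expR (- n%:R))) z : R)%:E).
  by apply/measurable_EFinP; apply: measurable_indic; exact: measurable_box.
have ge0 n z : (0 <= (\1_(box (expR (- n%:R))) z : R)%:E)%E by rewrite lee_fin indicE.
apply: (@le_trans _ _ (\int[leb4s R]_z (\sum_(0 <= n <oo) (\1_(box (expR (- n%:R))) z)%:E))%E).
  apply: ge0_le_integral => //.
  - by move=> x _; rewrite lee_fin log1_ge0.
  - by apply: (@ge0_emeasurable_sum _ (mpt4 R)) => //.
  - by move=> x _; exact: log1_le_series.
rewrite (@integral_nneseries _ (mpt4 R) R (leb4s R) setT measurableT)//.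
have In n : (\int[leb4s R]_x (\1_(box (expR (- n%:R))) x)%:E = (16 * q ^+ n)%:E)%E.
  have [i1 i2] := @integrable_box_cst R 1 (expR (- n%:R)) (expR_ge0 _).
  transitivity ((Rintegral (leb4s R) setT (fun z => 1 * \1_(box (expR (- n%:R))) z))%:E).
    rewrite /Rintegral fineK ?integrable_fin_num//.
    by apply: eq_integral => z _; rewrite mul1r.
  rewrite i2 mul1r exprMn /q -mulNrn -[_ *+ n]mulr_natl expRM_natl -!exprM mulnC; congr EFin; ring.
rewrite (eq_eseriesr (fun n _ => In n)).
apply: lime_le; first by apply: is_cvg_nneseries => n _ _; rewrite lee_fin mulr_ge0// exprn_ge0.
apply: nearW => n; rewrite sumEFin lee_fin.
rewrite ler_pdivlMr ?subr_gt0//.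
have -> : (\sum_(0 <= i < n) 16 * q ^+ i) * (1 - q) = 16 * (1 - q ^+ n).
  elim: n => [|n IH]; first by rewrite big_geq// mul0r expr0 subrr mulr0.
  by rewrite big_nat_recr//= mulrDl IH exprS; ring.
by rewrite ler_piMr// gerBl exprn_ge0.
Qed.

End log_kernel.

(** * Weighted growth of the positive part *)

Section growth.
Variable R : realType.
Implicit Types (x y z : pt4 R) (r t : R).

Definition logpot (rho : pt4 R -> R) x : \bar R :=
  (\int[leb4s R]_y (log1 (edist4 x y) * rho y)%:E)%E.

Section logpot.
Variable rho : pt4 R -> R.
Hypotheses (rho0 : forall y, 0 <= rho y) (mrho : measurable_fun [set: mpt4 R] rho).

Let F (w : pt4 R * pt4 R) : \bar R := (log1 (edist4 w.1 w.2) * rho w.2)%:E.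

Let F0 w : (0 <= F w)%E.
Proof. by rewrite lee_fin mulr_ge0// log1_ge0. Qed.

Let mF : measurable_fun [set: (mpt4 R * mpt4 R)%type] F.
Proof.
apply/measurable_EFinP; apply: measurable_funM.
  exact: (measurableT_comp (@measurable_log1 R) (@measurable_edist4 R)).
exact: (measurableT_comp mrho measurable_snd).
Qed.

Lemma logpot_ge0 x : (0 <= logpot rho x)%E.
Proof. by apply: integral_ge0 => y _; exact: (F0 (x, y)). Qed.

Lemma measurable_logpot : measurable_fun [set: mpt4 R] (logpot rho).
Proof. exact: (@measurable_fun_fubini_tonelli_F _ _ (mpt4 R) (mpt4 R) R (leb4s R) F mF F0). Qed.

Lemma integral_logpot (L M : R) : 0 <= L ->
  (forall y, (\int[leb4s R]_x (log1 (edist4 x y))%:E <= L%:E)%E) ->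
  (\int[leb4s R]_y (rho y)%:E <= M%:E)%E ->
  (\int[leb4s R]_x logpot rho x <= (L * M)%:E)%E.
Proof.
move=> L0 hL hM.
have -> : (\int[leb4s R]_x logpot rho x = \int[leb4s R]_y \int[leb4s R]_x F (x, y))%E.
  exact: (@fubini_tonelli _ _ (mpt4 R) (mpt4 R) R (leb4s R) (leb4s R) F mF F0).
have mG := @measurable_fun_fubini_tonelli_G _ _ (mpt4 R) (mpt4 R) R (leb4s R) F mF F0.
have mr : measurable_fun [set: mpt4 R] (fun y => (rho y)%:E) by exact/measurable_EFinP.
have r0 y : (0 <= (rho y)%:E)%E by rewrite lee_fin.
apply: (@le_trans _ _ (\int[leb4s R]_y (L%:E * (rho y)%:E))%E).
  have mLr : measurable_fun [set: mpt4 R] (fun y => L%:E * (rho y)%:E)%E.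
    by apply: emeasurable_funM => //; exact: measurable_cst.
  apply: (@ge0_le_integral _ (mpt4 R)) => //.
  - by move=> y _; apply: integral_ge0 => x _; exact: (F0 (x, y)).
  - move=> y _.
    have ml : measurable_fun [set: mpt4 R] (fun x => (log1 (edist4 x y))%:E).
      apply/measurable_EFinP; apply: (measurableT_comp (@measurable_log1 R)).
      exact: (@measurable_fun_pair1 _ _ _ (mpt4 R) (mpt4 R) R _ y (@measurable_edist4 R)).
    under eq_integral do rewrite /F /= EFinM muleC.
    rewrite ge0_integralZl//; last by move=> x _; rewrite lee_fin log1_ge0.
    by rewrite muleC lee_wpmul2r.
by rewrite ge0_integralZl// EFinM lee_wpmul2l ?lee_fin.
Qed.

End logpot.

(** The weight is at most r^2 and supported in the box of radius [r]: the integrable terms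
    contribute r^2, the linear term r^7, and the region inside radius [R1], where continuity bounds
    [h], contributes r^6. *)
Lemma growth_bound (h rho : pt4 R -> R) (c1 c2 R1 M : R) : continuous h ->
  (forall y, 0 <= rho y) -> measurable_fun [set: mpt4 R] rho ->
  (\int[leb4s R]_y (rho y)%:E <= M%:E)%E -> 0 <= c1 -> 0 <= c2 ->
  (forall r, {ae leb4s R, forall z, `|z| < r -> R1 <= enorm4 z ->
    ((pp (h z))%:E <= (rho z + c1 * enorm4 z)%:E + c2%:E * logpot rho z)%E}) ->
  exists C0, forall r, 1 <= r -> J (fun z => pp (h z) * kern 1 r 0 z) <= C0 * r ^+ 8.
Proof.
move=> ch rho0 mrho iM c10 c20 hae.
have [L L0 hL] := integral_log1_fin R.
have cpp : continuous (fun z => pp (h z)).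
  by move=> z; apply: continuous_comp; [exact: ch|exact: continuous_pp].
have [M0 M00 hM0] := continuous_box_bounded R1 cpp.
have M_0 : 0 <= M.
  by rewrite -lee_fin; apply: le_trans iM; apply: integral_ge0 => y _; rewrite lee_fin.
exists (M + c2 * (L * M) + (c1 * 2 + M0) * 16) => r r1.
have r0 : 0 < r by lra.
have r20 : 0 <= r ^+ 2 by exact: sqr_ge0.
have ccf : cc (fun z => pp (h z) * kern 1 r 0 z) by apply: ccM => //; exact: cc_kern.
(* On the box of radius [r] the Euclidean norm is at most 2 r; [M0] covers the points inside radius
   [R1]. *)
pose c := c1 * (2 * r) + M0.
have c0 : 0 <= c by rewrite addr_ge0// mulr_ge0// mulr_ge0// ltW.
have [ib ibE] := integrable_box_cst c (ltW r0).
have mr : measurable_fun [set: mpt4 R] (fun y => (rho y)%:E) by exact/measurable_EFinP.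
have rE0 y : (0 <= (rho y)%:E)%E by rewrite lee_fin.
have mN := measurable_logpot rho0 mrho.
have N0 := logpot_ge0 rho0.
have mI : measurable_fun [set: mpt4 R] (fun z => (c * \1_(box r) z)%:E) := measurable_int _ ib.
have I0 z : (0 <= (c * \1_(box r) z)%:E)%E by rewrite lee_fin mulr_ge0// indicE.
have mcN : measurable_fun [set: mpt4 R] (fun z => c2%:E * logpot rho z)%E.
  by apply: emeasurable_funM => //; exact: measurable_cst.
have cN0 z : (0 <= c2%:E * logpot rho z)%E by rewrite mule_ge0// lee_fin.
pose G2 z := (c2%:E * logpot rho z + (c * \1_(box r) z)%:E)%E.
pose G1 z := ((rho z)%:E + G2 z)%E.
have mG2 : measurable_fun [set: mpt4 R] G2 by exact: emeasurable_funD.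
have G20 z : (0 <= G2 z)%E by rewrite adde_ge0.
have mG1 : measurable_fun [set: mpt4 R] G1 by exact: emeasurable_funD.
have G10 z : (0 <= G1 z)%E by rewrite adde_ge0.
have iI : (\int[leb4s R]_z (c * \1_(box r) z)%:E = (c * (2 * r) ^+ 4)%:E)%E.
  by rewrite -ibE fineK//; exact: integrable_fin_num.
have B : (\int[leb4s R]_z ((r ^+ 2)%:E * G1 z) <= (r ^+ 2 * (M + (c2 * (L * M) + c * (2 * r)
  ^+ 4)))%:E)%E.
  rewrite ge0_integralZl// [leRHS]EFinM lee_wpmul2l ?lee_fin//.
  rewrite /G1 ge0_integralD// [leRHS]EFinD leeD//.
  rewrite /G2 ge0_integralD// iI [leRHS]EFinD leeD//.
  rewrite ge0_integralZl// [leRHS]EFinM lee_wpmul2l ?lee_fin//.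
  exact: integral_logpot.
have A : (\int[leb4s R]_z (pp (h z) * kern 1 r 0 z)%:E <= \int[leb4s R]_z ((r ^+ 2)%:E * G1 z))%E.
  apply: (@ae_ge0_le_integral _ (mpt4 R) R (leb4s R) setT measurableT) => //.
  - by move=> z _; rewrite lee_fin mulr_ge0 ?pp_ge0 ?kern_ge0.
  - apply/measurable_EFinP; apply: continuous_measurable_pt4; exact: ccf.1.
  - by move=> z _; rewrite mule_ge0.
  - by apply: emeasurable_funM => //; exact: measurable_cst.
  - case: (hae r) => N [mNn muN sN]; exists N; split => //.
    apply: subset_trans sN; apply: subsetC => z /= hz _.
    have [zr|zr] := leP r `|z|.
      by rewrite kern_far ?subr0 ?(ltW r0)// mulr0 mule_ge0.
    have i1 : \1_(box r) z = 1 :> R.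
      by rewrite indicE mem_set//; apply/boxP; exact: ltW.
    have k1 : kern 1 r 0 z <= r ^+ 2 by have := kern_le 1 r 0 z; rewrite expr1.
    apply: (@le_trans _ _ ((r ^+ 2)%:E * (pp (h z))%:E)%E).
      by rewrite -EFinM lee_fin mulrC ler_wpM2r ?pp_ge0.
    rewrite lee_wpmul2l//.
    have [zR|zR] := leP R1 (enorm4 z).
      apply: le_trans (hz zr zR) _.
      rewrite /G1 /G2 i1 mulr1 EFinD -addeA leeD2l// addeC leeD2l// lee_fin /c.
      rewrite -[leLHS]addr0 lerD// ler_wpM2l//; apply: le_trans (enorm4_le z) _.
      by rewrite ler_wpM2l// ltW.
    have : pp (h z) <= M0.
      apply: le_trans (ler_norm _) _; apply: hM0.
      by apply: le_trans (norm_pt4_enorm4 z) _; exact: ltW.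
    move=> hz0; rewrite /G1 /G2 i1 mulr1 addeA; apply: (@le_trans _ _ (0 + c%:E)%E).
      by rewrite add0e lee_fin /c; apply: le_trans hz0 _; rewrite lerDr mulr_ge0// mulr_ge0// ltW.
    by rewrite leeD2r// adde_ge0.
have := le_trans A B; rewrite -J_EFin// lee_fin => h1.
apply: le_trans h1 _.
have e1 : r ^+ 2 <= r ^+ 8 by rewrite ler_weXn2l.
have -> : r ^+ 2 * (M + (c2 * (L * M) + c * (2 * r) ^+ 4)) =
  (M + c2 * (L * M)) * r ^+ 2 + (c1 * 2) * 16 * r ^+ 7 + M0 * 16 * r ^+ 6 by rewrite /c; ring.
have e2 : r ^+ 7 <= r ^+ 8 by rewrite ler_weXn2l.
have e3 : r ^+ 6 <= r ^+ 8 by rewrite ler_weXn2l.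
have p1 : 0 <= M + c2 * (L * M) by rewrite addr_ge0// mulr_ge0// mulr_ge0.
have p2 : 0 <= (c1 * 2) * 16 by rewrite !mulr_ge0.
have p3 : 0 <= M0 * 16 by rewrite mulr_ge0.
have -> : (M + c2 * (L * M) + (c1 * 2 + M0) * 16) * r ^+ 8 =
  (M + c2 * (L * M)) * r ^+ 8 + (c1 * 2) * 16 * r ^+ 8 + M0 * 16 * r ^+ 8 by ring.
by apply: lerD; [apply: lerD|]; exact: ler_wpM2l.
Qed.

End growth.

(** * From the hypotheses on u and v to the growth bound *)

Section assembly.
Variable R : realType.
Implicit Types (x y z : pt4 R) (r t : R).

Lemma measurable_ball4 x r : measurable (ball4 x r : set (mpt4 R)).
Proof.
have m := @measurable_fun_pair2 _ _ _ (mpt4 R) (mpt4 R) R _ x (@measurable_edist4 R).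
have -> : ball4 x r = setT `&` (fun y => edist4 x y) @^-1` `]-oo, r[%classic.
  by rewrite setTI; apply/seteqP; split => y; rewrite /ball4 /= in_itv.
exact: m.
Qed.

Lemma ball_log_integral_le (g : pt4 R -> R) x : measurable_fun [set: mpt4 R] g ->
  (\int[leb4s R]_(y in ball4 x 1) (ln (edist4 x y) * g y)%:E <= logpot (fun y => `|g y|%R) x)%E.
Proof.
move=> mg; have mb := measurable_ball4 x 1.
have mf : measurable_fun [set: mpt4 R] (fun y => (ln (edist4 x y) * g y)%:E).
  apply/measurable_EFinP; apply: measurable_funM => //.
  apply: (measurableT_comp (@measurable_ln R)).
  exact: (@measurable_fun_pair2 _ _ _ (mpt4 R) (mpt4 R) R _ x (@measurable_edist4 R)).
apply: le_trans (lee_abs _) _.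
apply: le_trans (@le_abse_integral _ (mpt4 R) R (leb4s R)
  _ _ mb (measurable_funS measurableT (@subsetT _ _) mf)) _.
rewrite integral_mkcond /logpot le_eqVlt; apply/orP; left; apply/eqP; apply: eq_integral => y _.
rewrite patchE /log1 indicE; case: ifPn => [/set_mem yx|/negP yx].
  by rewrite mem_set ?mulr1 -?normrM//= in_itv.
rewrite memNset ?mulr0 ?mul0r// => /=; rewrite in_itv/= => yx'; apply: yx.
exact/mem_set.
Qed.

Lemma le_expR4 t : t <= expR (4 * t).
Proof.
have [t0|t0] := leP t 0; first by apply: le_trans t0 _; exact: expR_ge0.
by apply: le_trans (expR_ge1Dx _); lra.
Qed.

(** The threshold gives |x|^p >= 2, hence |1 - |x|^p| >= 1, and [u] is below its own exponential. *)
Lemma le_density p (u : pt4 R -> R) x : 0 < p -> 2 `^ p^-1 <= enorm4 x ->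
  u x <= `|Kp4 p x * expR (4 * u x)|.
Proof.
move=> p0 px; have e0 := expR_ge0 (4 * u x).
have k2 : 2 <= enorm4 x `^ p.
  apply: le_trans (ge0_ler_powR (ltW p0) _ _ px); rewrite ?nnegrE ?powR_ge0 ?sqrtr_ge0//.
  by rewrite -powRrM mulVf ?gt_eqF// powRr1.
apply: le_trans (le_expR4 (u x)) _; rewrite normrM (ger0_norm e0).
rewrite ler_peMl// /Kp4 ler0_norm; lra.
Qed.

Lemma Ck4S k (f : pt4 R -> R) : Ck4 k.+1 f -> Ck4 k f.
Proof.
elim: k f => [|k IH] f cf; first exact: Ck4_continuous cf.
by case: cf => df cf; split=> // i; apply: IH; exact: cf.
Qed.

End assembly.

Unset Implicit Arguments.

(** The potential is extended-real-valued, so its pointwise hypotheses are restricted to the points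
    where it is finite; local integrability makes these almost all points. *)
Theorem theorem3p1 (R : realType) (p : R) (u h : pt4 R -> R) :
  0 < p ->
  dist_solution4 p u ->
  (@leb4 R).-integrable setT (fun y => (Kp4 p y * expR (4 * u y))%:E) ->
  Lloc_e4 (vpot4 p u) ->
  (forall eps : R, 0 < eps -> exists R0 : R, 0 < R0 /\
     forall x : pt4 R, R0 <= enorm4 x -> vpot4 p u x \is a fin_num ->
       (- vpot4 p u x <=
        ((8 * pi ^+ 2)^-1 * (Lam4 p u + 5 * eps) * ln (enorm4 x))%R%:E +
        ((8 * pi ^+ 2)^-1)%R%:E *
          \int[@leb4 R]_(y in ball4 x 1)
             (ln (edist4 x y) * Kp4 p y * expR (4 * u y))%R%:E)%E) ->
  Ck4 4 h ->
  (forall x, bilap4 h x = 0) ->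
  (forall x, vpot4 p u x \is a fin_num -> ((h x)%:E <= (u x)%:E - vpot4 p u x)%E) ->
  poly_deg_le24 h.
Proof.
move=> p0 _ imu lv hv ch b0 hu.
pose g (y : pt4 R) := Kp4 p y * expR (4 * u y).
have ig : (leb4s R).-integrable setT (EFin \o g) := imu.
have mg : measurable_fun [set: mpt4 R] g by apply/measurable_EFinP; exact: measurable_int ig.
pose rho y := `|g y|.
have mrho : measurable_fun [set: mpt4 R] rho by exact: (measurableT_comp (@normr_measurable R
  setT) mg).
have rho0 y : 0 <= rho y by exact: normr_ge0.
have irho : (\int[leb4s R]_y (rho y)%:E < +oo)%E by case/integrableP : ig.
have irho0 : (0 <= \int[leb4s R]_y (rho y)%:E)%E by apply: integral_ge0 => y _;
  rewrite lee_fin rho0.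
pose M := fine (\int[leb4s R]_y (rho y)%:E)%E.
have hM : (\int[leb4s R]_y (rho y)%:E <= M%:E)%E by rewrite fineK// ge0_fin_numE.
(* Any fixed multiple of the logarithm is harmless, so one value of epsilon suffices. *)
have [R0 [R00 hR]] := hv 1 ltr01.
pose c8 : R := (8 * pi ^+ 2)^-1.
have c80 : 0 <= c8 by rewrite invr_ge0 mulr_ge0// sqr_ge0.
pose c1 := c8 * `|Lam4 p u + 5 * 1|.
have c10 : 0 <= c1 by rewrite mulr_ge0.
(* Beyond [R0] the bound on -v holds, beyond 1 the logarithm is nonnegative, and the last threshold
   is that of [le_density]. *)
pose R1 := Num.max R0 (Num.max 1 (2 `^ p^-1)).
have pointwise z : R1 <= enorm4 z -> vpot4 p u z \is a fin_num ->
    ((pp (h z))%:E <= (rho z + c1 * enorm4 z)%:E + c8%:E * logpot rho z)%E.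
  rewrite /R1 !ge_max => /andP[zR0 /andP[z1 zp]] vz.
  have N0 : (0 <= c8%:E * logpot rho z)%E.
    by rewrite mule_ge0 ?lee_fin//; apply: logpot_ge0.
  have e0 : 0 <= enorm4 z by exact: le_trans ler01 z1.
  have [hz|hz] := leP (h z) 0.
    by rewrite pp_neg// adde_ge0// lee_fin addr_ge0 ?rho0// mulr_ge0.
  rewrite (pp_pos (ltW hz)); apply: le_trans (hu z vz) _.
  rewrite EFinD -addeA; apply: leeD; first by rewrite lee_fin; exact: le_density.
  apply: le_trans (hR z zR0 vz) _; apply: leeD.
    rewrite lee_fin -mulrA -[leRHS]mulrA ler_wpM2l//.
    have lz : ln (enorm4 z) <= enorm4 z by apply/ltW/ln_sublinear; exact: lt_le_trans ltr01 z1.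
    apply: le_trans (ler_wpM2l (normr_ge0 _) lz).
    by rewrite ler_wpM2r ?ln_ge0 ?ler_norm.
  apply: lee_wpmul2l; first by rewrite lee_fin.
  have := @ball_log_integral_le R g z mg.
  have -> : (fun y => (ln (edist4 z y) * g y)%:E) =
      (fun y => (ln (edist4 z y) * Kp4 p y * expR (4 * u y))%:E).
    by apply/funext => y; rewrite /g mulrA.
  exact.
have hae r : {ae leb4s R, forall z, `|z| < r -> R1 <= enorm4 z ->
    ((pp (h z))%:E <= (rho z + c1 * enorm4 z)%:E + c8%:E * logpot rho z)%E}.
  (* Integrability makes the potential finite almost everywhere on this ball; the Euclidean radius 2
     r covers the sup ball of radius [r]. *)
  have lvr : (leb4s R).-integrable (ball4 (mkpt4 (fun=> 0)) (2 * r)) (vpot4 p u) := lv (2 * r).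
  case: (integrable_ae (@measurable_ball4 R _ _) lvr) => N [mN muN sN]; exists N; split => //.
  apply: subset_trans sN; apply: subsetC => z /= hz zr zR1; apply: pointwise => //; apply: hz.
  rewrite /ball4 /= edist4E mkpt40 sub0r; apply: le_lt_trans (enorm4_le _) _.
  by rewrite normrN ltr_pM2l.
have [C0 growth] := growth_bound (Ck4_continuous ch) rho0 mrho hM c10 c80 hae.
have ch2 : Ck4 2 h := @Ck4S R 2 h (@Ck4S R 3 h ch).
apply: third_difference0_quadratic => // *.
exact: (third_difference0 ch b0 growth).
Qed.
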